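(* Let $(N,g)$ be a Riemannian manifold, let $V\colon N\to\mathbb{R}$ be smooth, and let $\phi\colon\mathbb{R}^n\to N$ be a smooth harmonic map with potential, i.e. $\tau(\phi)=-\nabla V(\phi)$. Suppose that $V(\phi)\leq 0$. Then, for every $x\in\mathbb{R}^n$ and $r>0$, $$\frac{d}{dr}\Big(\frac{1}{r^{n-2}}\int_{B_r(x)}\big(\tfrac12|d\phi|^2-V(\phi)\big)dx\Big)\geq 0,$$ where $B_r(x)$ is the ball with radius $r$ around $x$ in $\mathbb{R}^n$.
   Context: $\mathbb{R}^n$ carries the Euclidean metric. The tension field $\tau(\phi)\in\Gamma(\phi^*TN)$ is the trace of the second fundamental form $\nabla d\phi$; $\nabla V$ is the gradient of $V$ on $(N,g)$. *)

(* Defs.v *)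
From HB Require Import structures.
From mathcomp Require Import all_boot all_order all_algebra.
From mathcomp Require Import all_classical all_reals all_analysis.

Set Implicit Arguments.
Unset Strict Implicit.
Unset Printing Implicit Defensive.
Import Order.TTheory GRing.Theory Num.Theory.
Import numFieldNormedType.Exports.

Local Open Scope classical_set_scope.
Local Open Scope ring_scope.

(* ['rV[R]_n] carries the sup norm in the library: it induces the right topology
   and differential calculus, but the balls have to be taken for [enorm]. *)
Definition enorm (R : realType) n (v : 'rV[R]_n) : R :=
  Num.sqrt (\sum_(i < n) v 0 i ^+ 2).

Definition eball (R : realType) n (x : 'rV[R]_n) (r : R) : set 'rV[R]_n :=
  [set y | enorm (y - x) < r].

Section lebesgue_tuple.
Variable R : realType.

Let T := measurableTypeR R.

Definition tcons n (p : T * n.-tuple T) : n.+1.-tuple T := [tuple of p.1 :: p.2].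

Lemma measurable_tcons n : measurable_fun setT (@tcons n).
Proof.
exact: (measurable_cons (@measurable_fst _ _ _ _) (@measurable_snd _ _ _ _)).
Qed.

Section step.
Variables (n : nat) (mu : {sigma_finite_measure set (n.-tuple T) -> \bar R}).

Definition lebesgue_step : set (n.+1.-tuple T) -> \bar R :=
  pushforward (@lebesgue_measure R \x mu)%E (@tcons n).

Let step_measure : {measure set (n.+1.-tuple T) -> \bar R} :=
  measure_function_pushforward__canonical__measure_function_Measure
    (@lebesgue_measure R \x mu)%E (measurable_tcons (n := n)).

HB.instance Definition _ := isMeasure.Build _ _ _ lebesgue_step
  (measure0 step_measure) (measure_ge0 step_measure)
  (@measure_semi_sigma_additive _ _ _ step_measure).

Let sigma_finite_step : sigma_finite setT lebesgue_step.
Proof.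
have /sigma_finiteP[F [TF ndF Foo]] := sigma_finiteT (@lebesgue_measure R).
have /sigma_finiteP[G [TG ndG Goo]] := sigma_finiteT mu.
exists (fun k => (fun t : n.+1.-tuple T => thead t) @^-1` F k `&`
                 (fun t : n.+1.-tuple T => [tuple of behead t]) @^-1` G k).
  apply/esym/seteqP; split => // t _.
  have [i _ Fi] : (\bigcup_k F k) (thead t) by rewrite -TF.
  have [j _ Gj] : (\bigcup_k G k) [tuple of behead t] by rewrite -TG.
  exists (maxn i j) => //; split => /=.
    by move: Fi; exact/subsetPset/ndF/leq_maxl.
  by move: Gj; exact/subsetPset/ndG/leq_maxr.
move=> k; have [mF Fk] := Foo k; have [mG Gk] := Goo k; split.
  apply: measurableI; rewrite -[X in measurable X]setTI.
    exact: measurable_tnth.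
  exact: measurable_behead.
rewrite /lebesgue_step /pushforward.
rewrite (_ : _ @^-1` _ = F k `*` G k); last first.
  apply/seteqP; split => -[a t] /=; rewrite theadE => -[Fa Gt]; split => //.
    by move: Gt; congr G; apply/val_inj.
  by move: Gt; congr G; apply/val_inj.
by rewrite product_measure1E // lte_mul_pinfty // ge0_fin_numE.
Qed.

HB.instance Definition _ :=
  Measure_isSigmaFinite.Build _ _ _ lebesgue_step sigma_finite_step.

End step.

Fixpoint lebesgue_tuple n : {sigma_finite_measure set (n.-tuple T) -> \bar R} :=
  match n with
  | 0%N => \d_([tuple] : 0.-tuple T)
  | n'.+1 => lebesgue_step (lebesgue_tuple n')
  end.

Lemma lebesgue_tuple_box n (A : 'I_n -> set T) : (forall i, measurable (A i)) ->
  lebesgue_tuple n [set t | forall i, A i (tnth t i)] =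
  (\prod_(i < n) lebesgue_measure (A i))%E.
Proof.
elim: n A => [|n IH] A mA.
  by rewrite big_ord0 /= diracE mem_set //= => -[].
rewrite big_ord_recl /= -IH //.
rewrite /lebesgue_step /pushforward -product_measure1E //.
  congr (_ _); apply/seteqP; split => -[a t] /=.
    move=> h; split=> [|i]; first exact: (h ord0).
    by have := h (lift ord0 i); rewrite tnthS.
  move=> [h0 h] i; case: (unliftP ord0 i) => [j ->|-> //].
  by rewrite tnthS.
rewrite (_ : mkset _ = \bigcap_(i in setT) ((@tnth n T ^~ i) @^-1` A (lift ord0 i))).
  apply: fin_bigcap_measurable => // i _.
  by rewrite -[X in measurable X]setTI; exact: measurable_tnth.
by apply/seteqP; split => t /= h i; [move=> _; exact: h|exact: h].
Qed.

End lebesgue_tuple.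

(* Lebesgue integral over a subset of R^n; the measure lives on [n.-tuple R], the
   library having no sigma-algebra on ['rV[R]_n]. *)
Definition row_of_tuple (R : realType) n (t : n.-tuple (measurableTypeR R)) :
  'rV[R]_n := \row_i tnth t i.

Definition eintegral (R : realType) n (D : set 'rV[R]_n) (f : 'rV[R]_n -> R) : R :=
  \int[lebesgue_tuple R n]_(t in @row_of_tuple R n @^-1` D) f (row_of_tuple t).

Section partial.
Context (R : realType) (n : nat) (W : normedModType R).

Definition partial (i : 'I_n) (f : 'rV[R]_n -> W) : 'rV[R]_n -> W :=
  fun x => 'D_(delta_mx 0 i) f x.

(* C^oo on an open set [U]: all iterated partial derivatives, [f] included, are
   (Frechet) differentiable at every point of [U]. *)
Definition smooth_on (U : set 'rV[R]_n) (f : 'rV[R]_n -> W) :=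
  forall (s : seq 'I_n) x, U x -> differentiable (foldr partial f s) x.

End partial.

Record chart (R : realType) (m : nat) (N : topologicalType) := Chart {
  cdom : set N;
  ccod : set 'rV[R]_m;
  cto : N -> 'rV[R]_m;
  cfrom : 'rV[R]_m -> N;
  cdom_open : open cdom;
  ccod_open : open ccod;
  cto_sub : forall p, cdom p -> ccod (cto p);
  cfrom_sub : forall y, ccod y -> cdom (cfrom y);
  ctoK : forall p, cdom p -> cfrom (cto p) = p;
  cfromK : forall y, ccod y -> cto (cfrom y) = y;
  cto_continuous : {within cdom, continuous cto};
  cfrom_continuous : {within ccod, continuous cfrom}
}.

Definition overlap (R : realType) m (N : topologicalType) (c c' : chart R m N) :
  set 'rV[R]_m := [set y | ccod c y /\ cdom c' (cfrom c y)].

Definition transition (R : realType) m (N : topologicalType) (c c' : chart R m N) :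
  'rV[R]_m -> 'rV[R]_m := cto c' \o cfrom c.

Record manifold (R : realType) (m : nat) := Manifold {
  points :> topologicalType;
  points_hausdorff : hausdorff_space points;
  points_second_countable : @second_countable points;
  atlas : set (chart R m points);
  atlas_cover : forall p, exists2 c, atlas c & cdom c p;
  atlas_smooth : forall c c', atlas c -> atlas c' ->
    smooth_on (overlap c c') (transition c c')
}.

Definition bilin (R : realType) m (G : 'M[R]_m) (u v : 'rV[R]_m) : R :=
  (u *m G *m v^T) 0 0.

(* The metric tensor as the family of its component matrices [(g_ij)] in the
   charts of the atlas, subject to the transformation law of covariant 2-tensors. *)
Record riemannian_manifold (R : realType) (m : nat) := RiemannianManifold {
  underlying :> manifold R m;
  metric : chart R m underlying -> 'rV[R]_m -> 'M[R]_m;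
  metric_smooth : forall c, atlas c -> smooth_on (ccod c) (metric c);
  metric_sym : forall c y, atlas c -> ccod c y -> (metric c y)^T = metric c y;
  metric_pos : forall c y v, atlas c -> ccod c y -> v != 0 ->
    0 < bilin (metric c y) v v;
  metric_compat : forall c c' y, atlas c -> atlas c' -> overlap c c' y ->
    let J := jacobian (transition c c') y in
    metric c y = J *m metric c' (transition c c' y) *m J^T
}.

Section geometry.
Context (R : realType) (m : nat) (N : riemannian_manifold R m).
Implicit Types (c : chart R m N) (V : N -> R).

Definition smooth_function V :=
  forall c, atlas c -> smooth_on (ccod c) (V \o cfrom c).

Definition inv_metric c (y : 'rV[R]_m) : 'M[R]_m := invmx (metric c y).

Definition christoffel c (k i j : 'I_m) (y : 'rV[R]_m) : R :=
  2^-1 * \sum_(l < m) inv_metric c y k l *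
    (partial i (fun z => metric c z j l) y + partial j (fun z => metric c z i l) y
     - partial l (fun z => metric c z i j) y).

(* Components in the chart [c] of the gradient of [V] at [p]. *)
Definition gradient c V (p : N) : 'rV[R]_m :=
  \row_k \sum_(l < m)
    inv_metric c (cto c p) k l * partial l (V \o cfrom c : _ -> R) (cto c p).

Section maps.
Context (n : nat) (phi : 'rV[R]_n -> N).

Definition smooth_map := continuous phi /\
  forall c, atlas c -> smooth_on (phi @^-1` cdom c) (cto c \o phi).

(* Components in the chart [c] of [dphi (e_a)] at [x]. *)
Definition dmap c (a : 'I_n) : 'rV[R]_n -> 'rV[R]_m := partial a (cto c \o phi).

(* Components in the chart [c] of [(nabla dphi) (e_a, e_b)]; the Christoffel
   symbols of R^n vanish. *)
Definition second_fundamental_form c (a b : 'I_n) (x : 'rV[R]_n) : 'rV[R]_m :=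
  \row_k (partial a (dmap c b) x 0 k +
    \sum_(i < m) \sum_(j < m)
      christoffel c k i j (cto c (phi x)) * dmap c a x 0 i * dmap c b x 0 j).

Definition tension c (x : 'rV[R]_n) : 'rV[R]_m :=
  \sum_(a < n) second_fundamental_form c a a x.

Definition harmonic_with_potential V :=
  forall c x, atlas c -> cdom c (phi x) -> tension c x = - gradient c V (phi x).

Definition dmap_sqnorm_in c (x : 'rV[R]_n) : R :=
  \sum_(a < n) bilin (metric c (cto c (phi x))) (dmap c a x) (dmap c a x).

Definition chart_at (p : N) : chart R m N := s2val (cid2 (atlas_cover p)).

Definition dmap_sqnorm (x : 'rV[R]_n) : R := dmap_sqnorm_in (chart_at (phi x)) x.

(* The chart selected by [chart_at] is immaterial. *)
Lemma dmap_sqnormE c x : smooth_map -> atlas c -> cdom c (phi x) ->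
  dmap_sqnorm x = dmap_sqnorm_in c x.
Proof.
move=> [phic phis] ac cx; rewrite /dmap_sqnorm /chart_at.
case: cid2 => c' ac' c'x /=; apply: eq_bigr => a _.
set y := cto c' (phi x).
have oy : overlap c' c y.
  by split; [exact: cto_sub | rewrite /y ctoK].
have d' : differentiable (cto c' \o phi) x by exact: (phis _ ac' [::]).
have dt : differentiable (transition c' c) y by exact: (atlas_smooth ac' ac [::]).
have E : \forall z \near x, (cto c \o phi) z = (transition c' c \o (cto c' \o phi)) z.
  have : \forall z \near x, cdom c' (phi z).
    by apply: phic; apply: open_nbhs_nbhs; split => //; exact: cdom_open.
  by apply: filterS => z h; rewrite /transition /= ctoK.
have -> : dmap c a x = dmap c' a x *m jacobian (transition c' c) y.
  rewrite /dmap /partial (near_eq_derive _ E).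
  rewrite (deriveE _ (differentiable_comp d' dt)) (deriveE _ d').
  rewrite /jacobian mul_rV_lin1.
  exact: (congr1 (fun h : _ -> _ => h (delta_mx 0 a)) (diff_comp d' dt)).
rewrite (metric_compat ac' ac oy) /bilin.
rewrite /transition /= /y ctoK //.
by rewrite trmx_mul !mulmxA.
Qed.

End maps.
End geometry.

(* Main.v *)
Require Import Defs.
From HB Require Import structures.
From mathcomp Require Import all_boot all_order all_algebra.
From mathcomp Require Import all_classical all_reals all_analysis.
From mathcomp Require Import measurable_realfun.
From mathcomp Require Import ring lra.

Set Implicit Arguments.
Unset Strict Implicit.
Unset Printing Implicit Defensive.
Import Order.TTheory GRing.Theory Num.Theory.
Import numFieldNormedType.Exports.
Local Open Scope classical_set_scope.
Local Open Scope ring_scope.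

(** The proof is the classical argument from the conservation of the
stress-energy tensor, arranged so as to avoid surface integrals.

Write [e = |dphi|^2 / 2 - V(phi)] and let [S a b = <dphi(e_a), dphi(e_b)>] be
the pullback of the metric. Differentiating [S] and [e] in a chart and using the
equation [tau(phi) = - grad V(phi)] gives the conservation law
[d_b e = sum_a d_a (S a b)] ([energy_conservation]); beside the definition of the
Christoffel symbols this rests on the symmetry of second derivatives
([clairaut]) and of the metric ([dmetric_inner_conservation]).

Everything else is analysis on R^n ([stress_energy_monotonicity]). Rescaling the
ball, [s^(2-n) int_(B_s(x)) e = s^2 int_(B_1) e(x + s z) dz], so the derivative
at [r] can be taken under the integral sign. With the conservation law it is [r]
times

  [int_(B_1) (2 e(x + r z) + r sum_(a,b) z_b (d_a S a b)(x + r z)) dz].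

As [2 e = sum_a S a a - 2 V(phi)] and [V(phi) <= 0], the integrand is at least
the divergence of the field [X a z = sum_b z_b S a b (x + r z)]. This field
points outwards, [sum_a X a z * z_a >= 0], because [S] is positive semidefinite.

There remains to see that an outward pointing field has nonnegative total
divergence on the unit ball ([eintegral_div_ge0]). For radially decreasing C^1
cutoffs [eta] supported in the ball, [int div (eta X) = 0], hence
[int eta div X = - int <grad eta, X> >= 0], and [eta] is sent to the indicator
of the ball. The vanishing of [int d_a h] for a compactly supported [h] is in
turn the derivative at [0] of the constant function
[s |-> int h(z + s e_a) dz]. Both changes of variables, dilation and
translation, come from one affine formula for the Lebesgue measure, proved by
induction on the dimension with Tonelli's theorem ([eintegral_affine]). *)

(** * Partial derivatives and C^1 functions *)
Section calculus.
Variable R : realType.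

Lemma derive_rowE n (f : 'rV[R]_n -> R) (x v : 'rV[R]_n) : differentiable f x ->
  'D_v f x = \sum_(b < n) v 0 b * partial b f x.
Proof.
move=> df; rewrite deriveE// {1}(row_sum_delta v) linear_sum.
by apply: eq_bigr => b _; rewrite linearZ /partial deriveE.
Qed.

Lemma is_derive_line n (f : 'rV[R]_n -> R) (x v : 'rV[R]_n) (s : R) :
  differentiable f (x + s *: v) ->
  is_derive s 1 (fun t : R => f (x + t *: v)) ('D_v f (x + s *: v)).
Proof.
move=> df.
have E : (fun h : R => h^-1 *: (((fun t : R => f (x + t *: v)) \o shift s) (h *: 1)
    - f (x + s *: v))) =
    (fun h : R => h^-1 *: ((f \o shift (x + s *: v)) (h *: v) - f (x + s *: v))).
  apply/funext => h /=; congr (_ *: (f _ - _)).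
  by rewrite -[h%:A]/(h * 1) mulr1 scalerDl addrCA.
have dv : derivable f (x + s *: v) v by exact: diff_derivable.
by apply: DeriveDef; rewrite /derivable /derive E.
Qed.

Section partial_rules.
Variable n : nat.
Implicit Types (f g : 'rV[R]_n -> R) (y : 'rV[R]_n) (a : 'I_n).

Lemma differentiable_sumE m (F : 'I_m -> 'rV[R]_n -> R) y :
  (forall i, differentiable (F i) y) -> differentiable (fun z => \sum_(i < m) F i z) y.
Proof. by move=> dF; rewrite -fct_sumE; exact: differentiable_sum. Qed.

Lemma partialD f g y a : differentiable f y -> differentiable g y ->
  partial a (fun z => f z + g z) y = partial a f y + partial a g y.
Proof. by move=> df dg; apply: deriveD; exact: diff_derivable. Qed.

Lemma partialM f g y a : differentiable f y -> differentiable g y ->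
  partial a (fun z => f z * g z) y = f y * partial a g y + g y * partial a f y.
Proof. by move=> df dg; apply: deriveM; exact: diff_derivable. Qed.

Lemma partial_sum m (F : 'I_m -> 'rV[R]_n -> R) y a :
  (forall i, differentiable (F i) y) ->
  partial a (fun z => \sum_(i < m) F i z) y = \sum_(i < m) partial a (F i) y.
Proof.
move=> dF; rewrite -fct_sumE; apply: derive_sum => i; exact: diff_derivable.
Qed.

Lemma partial_cst (k : R) y a : partial a (fun=> k) y = 0.
Proof. exact: derive_cst. Qed.

Lemma partial_entry p q (f : 'rV[R]_n -> 'M[R]_(p, q)) y a i j :
  differentiable f y -> partial a f y i j = partial a (fun z => f z i j) y.
Proof. by move=> df; rewrite /partial derive_mx ?mxE//; exact: diff_derivable. Qed.

Lemma differentiable_entry p q (f : 'rV[R]_n -> 'M[R]_(p, q)) y i j :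
  differentiable f y -> differentiable (fun z => f z i j) y.
Proof. by move=> df; exact: (differentiable_comp df (differentiable_coord _ _ _)). Qed.

Lemma partial_comp m (u : 'rV[R]_n -> 'rV[R]_m) (g : 'rV[R]_m -> R) y a :
  differentiable u y -> differentiable g (u y) ->
  partial a (fun z => g (u z)) y = \sum_(l < m) partial l g (u y) * partial a u y 0 l.
Proof.
move=> du dg.
rewrite /partial (deriveE _ (differentiable_comp du dg)).
rewrite (congr1 (fun h : _ -> _ => h (delta_mx 0 a)) (diff_comp du dg)) /=.
rewrite -(deriveE _ du) -(deriveE _ dg) derive_rowE//.
by apply: eq_bigr => l _; rewrite mulrC.
Qed.

Lemma partial_comp1 f (g : R -> R) y a :
  differentiable f y -> derivable g (f y) 1 ->
  partial a (fun z => g (f z)) y = derive1 g (f y) * partial a f y.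
Proof.
move=> df /[dup] dg /derivable1_diffP dg'.
rewrite /partial (deriveE _ (differentiable_comp df dg')).
rewrite (congr1 (fun h : _ -> _ => h (delta_mx 0 a)) (diff_comp df dg')) /=.
by rewrite -(deriveE _ df) deriv1E// mulrC.
Qed.

Lemma partial_coord y a b : partial a (fun z : 'rV[R]_n => z 0 b) y = (a == b)%:R.
Proof.
by rewrite -(@partial_entry 1 n id)// /partial derive_id mxE eqxx/= eq_sym.
Qed.

End partial_rules.

(** The local form is what chart computations produce: a function built in a
chart is known only near the points mapped into the domain of this chart. *)
Definition C1_at n (y : 'rV[R]_n) (f : 'rV[R]_n -> R) :=
  (\forall z \near y, differentiable f z) /\
  forall a, {for y, continuous (partial a f)}.

Definition C1 n (f : 'rV[R]_n -> R) := forall y, C1_at y f.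

Section C1.
Variable n : nat.
Implicit Types (f g : 'rV[R]_n -> R) (y : 'rV[R]_n) (a : 'I_n).

Lemma C1_at_diff y f : C1_at y f -> differentiable f y.
Proof. by move=> [/nbhs_singleton]. Qed.

Lemma C1_at_cont y f : C1_at y f -> {for y, continuous f}.
Proof. by move=> /C1_at_diff; exact: differentiable_continuous. Qed.

Lemma C1_diff f : C1 f -> forall y, differentiable f y.
Proof. by move=> h y; exact: C1_at_diff. Qed.

Lemma C1_cont f : C1 f -> continuous f.
Proof. by move=> h y; exact: C1_at_cont. Qed.

Lemma C1_partial_cont f a : C1 f -> continuous (partial a f).
Proof. by move=> h y; have [_] := h y; exact. Qed.

Lemma continuous_at_sum m (F : 'I_m -> 'rV[R]_n -> R) y :
  (forall i, {for y, continuous (F i)}) ->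
  {for y, continuous (fun z => \sum_(i < m) F i z)}.
Proof.
elim: m F => [|m IH] F cF.
  by apply: (near_cst_continuous 0); near=> z; rewrite big_ord0.
rewrite (_ : (fun z => _) = (fun z =>
  \sum_(i < m) F (widen_ord (leqnSn m) i) z + F ord_max z)); last first.
  by apply/funext => z; rewrite big_ord_recr.
exact: (cvgD (IH _ (fun i => cF _)) (cF ord_max)).
Unshelve. all: by end_near. Qed.

(** Germs matter here because the globally defined energy density agrees with its
expression in a fixed chart only near a point. *)
Lemma near_eq_diff f g y : (\forall z \near y, f z = g z) ->
  differentiable f y -> differentiable g y.
Proof.
move=> fg df.
have lg : g \o shift y = cst (g y) + 'd f y +o_ (0 : 'rV[R]_n) id.
  apply/eqaddoP => e e0.
  have [_ /eqaddoP/(_ e e0)] := (diff_locallyP y f).1 df.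
  have : \forall z \near (0 : 'rV[R]_n), f (z + y) = g (z + y).
    by have := fg; rewrite (near_shift 0) subr0.
  apply: filterS2 => z E; rewrite -(nbhs_singleton fg).
  by rewrite !fctE/= E.
apply/diff_locallyP; rewrite (diff_unique (diff_continuous df) lg); split => //.
exact: diff_continuous df.
Qed.

Lemma near_eq_cont f g y : (\forall z \near y, f z = g z) ->
  {for y, continuous f} -> {for y, continuous g}.
Proof.
move=> fg cf; rewrite /prop_for /continuous_at -(nbhs_singleton fg).
exact: cvg_trans (near_eq_cvg fg) cf.
Qed.

Lemma near_eq_C1_at f g y : (\forall z \near y, f z = g z) -> C1_at y f -> C1_at y g.
Proof.
move=> /[dup] /near_join fg2 fg [df cf]; split.
  near=> z; apply: (@near_eq_diff f); near: z => //.
move=> a; apply: near_eq_cont (cf a).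
near=> z; apply: near_eq_derive; near: z; exact: fg2.
Unshelve. all: by end_near. Qed.

(** Continuity of a partial derivative is obtained from a formula for it that
holds near the point. *)
Lemma C1_at_build y f (D : 'I_n -> 'rV[R]_n -> R) :
  (\forall z \near y, differentiable f z) ->
  (forall a, \forall z \near y, D a z = partial a f z) ->
  (forall a, {for y, continuous (D a)}) -> C1_at y f.
Proof. by move=> df E cD; split => // a; apply: near_eq_cont (E a) (cD a). Qed.

Lemma C1_at_cst y (k : R) : C1_at y (fun=> k).
Proof.
apply: (@C1_at_build _ _ (fun=> fun=> 0)) => [|a|a]; last by apply: near_cst_continuous; near=> z.
  by near=> z; exact: differentiable_cst.
by near=> z; rewrite partial_cst.
Unshelve. all: by end_near. Qed.

Lemma C1_atD y f g : C1_at y f -> C1_at y g -> C1_at y (fun z => f z + g z).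
Proof.
move=> [df cf] [dg cg].
apply: (@C1_at_build _ _ (fun a z => partial a f z + partial a g z)) => [|a|a].
- by near=> z; apply: differentiableD; near: z.
- by near=> z; rewrite partialD//; near: z.
- exact: (cvgD (cf a) (cg a)).
Unshelve. all: by end_near. Qed.

Lemma C1_atM y f g : C1_at y f -> C1_at y g -> C1_at y (fun z => f z * g z).
Proof.
move=> /[dup] /C1_at_cont cf0 [df cf] /[dup] /C1_at_cont cg0 [dg cg].
apply: (@C1_at_build _ _ (fun a z => f z * partial a g z + g z * partial a f z)) => [|a|a].
- by near=> z; apply: differentiableM; near: z.
- by near=> z; rewrite partialM//; near: z.
- exact: (cvgD (cvgM cf0 (cg a)) (cvgM cg0 (cf a))).
Unshelve. all: by end_near. Qed.

Lemma C1_at_sum m y (F : 'I_m -> 'rV[R]_n -> R) : (forall i, C1_at y (F i)) ->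
  C1_at y (fun z => \sum_(i < m) F i z).
Proof.
elim: m F => [|m IH] F cF.
  by under eq_fun do rewrite big_ord0; exact: C1_at_cst.
under eq_fun do rewrite big_ord_recr/=.
by apply: C1_atD => //; exact: IH.
Qed.

Lemma C1_at_coord y b : C1_at y (fun z : 'rV[R]_n => z 0 b).
Proof.
apply: (@C1_at_build _ _ (fun a z => (a == b)%:R)) => [|a|a]; last by apply: near_cst_continuous; near=> z.
  by near=> z; exact: differentiable_coord.
by near=> z; rewrite partial_coord.
Unshelve. all: by end_near. Qed.

Lemma C1_at_comp1 y f (g : R -> R) : C1_at y f -> (forall t, derivable g t 1) ->
  continuous (derive1 g) -> C1_at y (fun z => g (f z)).
Proof.
move=> /[dup] /C1_at_cont cf0 [df cf] dg cg.
apply: (@C1_at_build _ _ (fun a z => derive1 g (f z) * partial a f z)) => [|a|a].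
- near=> z; apply: (@differentiable_comp _ _ _ _ f g); first by near: z.
  exact/derivable1_diffP.
- by near=> z; rewrite partial_comp1//; near: z.
- have cgf : {for y, continuous (fun z => derive1 g (f z))}.
    exact: (continuous_comp cf0 (cg (f y))).
  exact: (cvgM cgf (cf a)).
Unshelve. all: by end_near. Qed.

Lemma C1_at_comp m y (u : 'rV[R]_n -> 'rV[R]_m) (g : 'rV[R]_m -> R) :
  (\forall z \near y, differentiable u z) ->
  (forall i, C1_at y (fun z => u z 0 i)) ->
  C1_at (u y) g -> C1_at y (fun z => g (u z)).
Proof.
move=> du cu [dg cg].
have cuy : {for y, continuous u}.
  exact: differentiable_continuous (nbhs_singleton du).
have dgu : \forall z \near y, differentiable g (u z) by exact: cuy dg.
apply: (@C1_at_build _ _ (fun a z => \sum_(l < m) partial l g (u z) *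
    partial a (fun w => u w 0 l) z)) => [|a|a].
- near=> z; apply: (@differentiable_comp _ _ _ _ u g); first by near: z.
  by near: z.
- near=> z; rewrite partial_comp//.
  + by apply: eq_bigr => l _; rewrite partial_entry//; near: z.
  + by near: z.
  + by near: z.
- apply: continuous_at_sum => l.
  have [_ cul] := cu l.
  have cgu : {for y, continuous (fun z => partial l g (u z))}.
    exact: (continuous_comp cuy (cg l)).
  exact: (cvgM cgu (cul a)).
Unshelve. all: by end_near. Qed.

End C1.
End calculus.

(** * Symmetry of second derivatives *)
Section clairaut.
Variables (R : realType) (n : nat).
Implicit Types (f : 'rV[R]_n -> R) (y v w : 'rV[R]_n).

(** Two applications of the mean value theorem, first along [v] and then along
[w]. The left-hand side is symmetric in [v] and [w], which is the whole reason
for the symmetry of second derivatives. *)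
Lemma second_difference f y v w (h : R) : 0 < h -> `|v| <= 1 -> `|w| <= 1 ->
  (forall z, `|z - y| <= 2 * h -> differentiable f z) ->
  (forall z, `|z - y| <= 2 * h -> differentiable ('D_v f) z) ->
  exists2 z, `|z - y| <= 2 * h &
    f (y + h *: v + h *: w) - f (y + h *: v) - f (y + h *: w) + f y =
    h ^+ 2 * 'D_w ('D_v f) z.
Proof.
move=> h0 v1 w1 df ddf.
have inball s t : 0 <= s <= h -> 0 <= t <= h -> `|(y + s *: v + t *: w) - y| <= 2 * h.
  move=> /andP[s0 sh] /andP[t0 th].
  rewrite -[X in X - y]addrA (addrC y) addrK; apply: le_trans (ler_normD _ _) _.
  rewrite !normrZ !ger0_norm// mulrDl !mul1r; apply: lerD.
    by apply: le_trans sh; rewrite ler_piMr.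
  by apply: le_trans th; rewrite ler_piMr.
have h0' : 0 <= h by exact: ltW.
have hh : 0 <= h <= h by apply/andP; split.
have zh : (0 : R) <= 0 <= h by apply/andP; split.
have itvW s : s \in `]0, h[ -> 0 <= s <= h.
  by rewrite in_itv/= => /andP[? ?]; apply/andP; split; exact: ltW.
have itvcc s : s \in `[0, h] -> 0 <= s <= h by rewrite in_itv.
have dg s : 0 <= s <= h -> is_derive s 1
   (fun s => f (y + h *: w + s *: v) - f (y + s *: v))
   ('D_v f (y + h *: w + s *: v) - 'D_v f (y + s *: v)).
  move=> sh; apply: is_deriveB; apply: is_derive_line; apply: df.
    by rewrite (addrAC y (h *: w)); exact: inball.
  by have := inball s 0 sh zh; rewrite scale0r addr0.
have [c ch] := MVT h0 (fun s sh => dg s (itvW s sh)) (derivable_within_continuous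
  (fun s sh => @ex_derive _ _ _ _ _ _ _ (dg s (itvcc s sh)))).
rewrite /= !scale0r !addr0 subr0 => Ec.
have {}ch := itvW c ch.
have dk t : 0 <= t <= h -> is_derive t 1
   (fun t => 'D_v f (y + c *: v + t *: w)) ('D_w ('D_v f) (y + c *: v + t *: w)).
  by move=> th; apply: is_derive_line; apply: ddf; exact: inball.
have [d dh] := MVT h0 (fun t th => dk t (itvW t th)) (derivable_within_continuous
  (fun t th => @ex_derive _ _ _ _ _ _ _ (dk t (itvcc t th)))).
rewrite /= scale0r addr0 subr0 => Ed.
have {}dh := itvW d dh.
exists (y + c *: v + d *: w); first exact: inball.
rewrite (addrAC y (h *: w) (h *: v)) (addrAC y (h *: w) (c *: v)) Ed in Ec.
rewrite expr2 -mulrA (mulrC h) (mulrC h) -Ec; ring.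
Qed.

Lemma norm_delta (a : 'I_n) : `|delta_mx 0 a : 'rV[R]_n| <= 1.
Proof.
rewrite /Num.Def.normr/= mx_normrE; apply: bigmax_le => // i _.
by rewrite mxE; case: (_ && _); rewrite ?normr1 ?normr0.
Qed.

Lemma near_and5 y (P1 P2 P3 P4 P5 : set 'rV[R]_n) :
  nbhs y P1 -> nbhs y P2 -> nbhs y P3 -> nbhs y P4 -> nbhs y P5 ->
  \forall z \near y, [/\ P1 z, P2 z, P3 z, P4 z & P5 z].
Proof. by move=> *; near=> z; split; near: z. Unshelve. all: by end_near. Qed.

Lemma ler_dist_halves (e p q t : R) : `|q - t| < e / 2 -> `|p - t| < e / 2 -> `|p - q| <= e.
Proof.
by rewrite !ltr_norml ler_norml => /andP[? ?] /andP[? ?]; apply/andP; split; lra.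
Qed.

(** Evaluating the second difference in both orders equates the two mixed
derivatives at two points that tend to [y]. *)
Lemma clairaut f y (a b : 'I_n) : (\forall z \near y, differentiable f z) ->
  C1_at y (partial a f) -> C1_at y (partial b f) ->
  partial a (partial b f) y = partial b (partial a f) y.
Proof.
move=> df [da ca] [db cb].
apply/eqP; rewrite -subr_eq0 -normr_le0; apply/ler_addgt0Pl => e e0; rewrite addr0.
have e2 : 0 < e / 2 by rewrite divr_gt0.
have /cvgrPdist_lt/(_ _ e2) na := ca b.
have /cvgrPdist_lt/(_ _ e2) nb := cb a.
have : \forall z \near y, [/\ differentiable f z, differentiable (partial a f) z,
  differentiable (partial b f) z, `|partial b (partial a f) y - partial b (partial a f) z| < e / 2 &
  `|partial a (partial b f) y - partial a (partial b f) z| < e / 2].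
  exact: near_and5 df da db na nb.
move=> /nbhs_ballP[r /= r0 rball].
(* The points of [second_difference] are within [2 * h] of [y]. *)
pose h := r / 4.
have h0 : 0 < h by rewrite divr_gt0.
have inr z : `|z - y| <= 2 * h -> ball y r z.
  by rewrite -ball_normE /= distrC => /le_lt_trans; apply; rewrite /h; lra.
have [z1 z1y E1] := @second_difference f y (delta_mx 0 a) (delta_mx 0 b) h h0
  (norm_delta a) (norm_delta b) (fun z zy => let: And5 d _ _ _ _ := rball z (inr z zy) in d)
  (fun z zy => let: And5 _ d _ _ _ := rball z (inr z zy) in d).
have [z2 z2y E2] := @second_difference f y (delta_mx 0 b) (delta_mx 0 a) h h0
  (norm_delta b) (norm_delta a) (fun z zy => let: And5 d _ _ _ _ := rball z (inr z zy) in d)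
  (fun z zy => let: And5 _ _ d _ _ := rball z (inr z zy) in d).
have E : partial b (partial a f) z1 = partial a (partial b f) z2.
  have h2 : h ^+ 2 != 0 by rewrite expf_neq0// gt_eqF.
  apply: (mulfI h2); rewrite -[LHS]E1 -[RHS]E2 (addrAC y).
  by rewrite -!addrA; congr (_ + _); rewrite !addrA; congr (_ + _); rewrite addrC.
have [_ _ _ h1 _] := rball z1 (inr z1 z1y).
have [_ _ _ _ h2] := rball z2 (inr z2 z2y).
rewrite E in h1.
exact: ler_dist_halves h1 h2.
Qed.

End clairaut.

(** * Lebesgue measure under affine maps *)
Section lebesgue_affine.
Variable R : realType.
Let T := measurableTypeR R.

Definition affine_tuple n (x : n.-tuple T) (s : R) (t : n.-tuple T) : n.-tuple T :=
  [tuple (tnth x i + s * tnth t i : T) | i < n].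

Lemma measurable_affine_tuple n (x : n.-tuple T) s :
  measurable_fun setT (affine_tuple x s).
Proof.
apply/measurable_fun_tnthP => i.
rewrite (_ : _ \o _ = fun t => tnth x i + s * tnth t i); last first.
  by apply/funext => t /=; rewrite tnth_mktuple.
apply: measurable_funD => //; apply: measurable_funM => //.
exact: measurable_tnth.
Qed.

Lemma measurable_affine (x s : R) : measurable_fun setT ((fun u => x + s * u) : T -> T).
Proof. by apply: measurable_funD => //; apply: measurable_funM. Qed.

(** In dimension one the rescaled pushforward of the Lebesgue measure has the
right value on half-open intervals, which determine it. *)
Lemma ge0_integral_affine (x s : R) (f : T -> \bar R) : 0 < s ->
  measurable_fun setT f -> (forall u, 0 <= f u)%E ->
  (\int[lebesgue_measure]_u f u = s%:E * \int[lebesgue_measure]_u f (x + s * u)%R)%E.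
Proof.
move=> s0 mf f0.
have s0' : 0 <= s by exact: ltW.
pose aff := (fun u => x + s * u) : T -> T.
have maff : measurable_fun setT aff := measurable_affine x s.
pose pm : {measure set T -> \bar R} :=
  measure_function_pushforward__canonical__measure_function_Measure
    (@lebesgue_measure R) maff.
transitivity (\int[mscale (NngNum s0') pm]_u f u)%E.
  apply: eq_measure_integral => A mA _; apply: lebesgue_measure_unique => //.
  move=> _ [[a b]] _ <- /=; rewrite /mscale/= /pushforward.
  have -> : aff @^-1` `]a, b] = `](a - x) / s, (b - x) / s]%classic.
    apply/seteqP; split=> u /=; rewrite !in_itv/= /aff ltr_pdivrMr// ler_pdivlMr//.
      by move=> /andP[? ?]; apply/andP; split; lra.
    by move=> /andP[? ?]; apply/andP; split; lra.
  rewrite !lebesgue_measure_itv/= !lte_fin ltr_pM2r ?invr_gt0// ltrD2r.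
  case: ifPn => _; last by rewrite mule0.
  rewrite -!EFinD -EFinM; congr EFin; field; lra.
rewrite ge0_integral_mscale//=; congr (_ * _)%E.
rewrite ge0_integral_pushforward//.
Qed.

Lemma measurable_tconsl n (f : n.+1.-tuple T -> \bar R) (a : T) :
  measurable_fun setT f -> measurable_fun setT (fun t => f (tcons (a, t))).
Proof.
move=> mf; exact: (measurableT_comp mf (measurableT_comp (@measurable_tcons R n) (pair1_measurable a))).
Qed.

Lemma ge0_integral_lebesgue_tupleS n (f : n.+1.-tuple T -> \bar R) :
  measurable_fun setT f -> (forall u, 0 <= f u)%E ->
  (\int[lebesgue_tuple R n.+1]_t f t =
   \int[lebesgue_measure]_a \int[lebesgue_tuple R n]_t f (tcons (a, t)))%E.
Proof.
move=> mf f0.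
pose pm : {measure set (n.+1.-tuple T) -> \bar R} :=
  measure_function_pushforward__canonical__measure_function_Measure
    (@lebesgue_measure R \x lebesgue_tuple R n)%E (measurable_tcons (n := n)).
transitivity (\int[pm]_t f t)%E; first exact: eq_measure_integral.
rewrite (ge0_integral_pushforward (@measurable_tcons R n))//.
rewrite preimage_setT.
rewrite fubini_tonelli1; [by []|exact: (measurableT_comp mf (@measurable_tcons R n))|move=> p; exact: f0].
Qed.

(** Induction on the dimension: Tonelli splits off the first coordinate, which
contributes one factor [s] by the one-dimensional case. *)
Lemma ge0_integral_affine_tuple n (x : n.-tuple T) (s : R) (f : n.-tuple T -> \bar R) : 0 < s ->
  measurable_fun setT f -> (forall u, 0 <= f u)%E ->
  (\int[lebesgue_tuple R n]_t f t =
   (s ^+ n)%:E * \int[lebesgue_tuple R n]_t f (affine_tuple x s t))%E.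
Proof.
move=> s0; elim: n x f => [|n IH] x f mf f0.
  rewrite expr0 mul1e; apply: eq_integral => t _; congr f.
  by rewrite [t]tuple0 [affine_tuple _ _ _]tuple0.
have mfa : measurable_fun setT (fun t => f (affine_tuple x s t)).
  exact: (measurableT_comp mf (measurable_affine_tuple _ _)).
rewrite !ge0_integral_lebesgue_tupleS//.
pose x' := [tuple of behead x].
have consE a t : affine_tuple x s (tcons (a, t)) =
    tcons (tnth x ord0 + s * a, affine_tuple x' s t).
  apply: eq_from_tnth => i; rewrite tnth_mktuple.
  case: (unliftP ord0 i) => [j ->|->] /=.
    by rewrite !tnthS !tnth_mktuple tnth_behead; congr (tnth x _ + _); apply/val_inj; rewrite /= inordK// ltnS.
  by rewrite !(tnth_nth 0) /=.
under eq_integral => a _ do rewrite (IH x' (fun t => f (tcons (a, t))) (measurable_tconsl _ mf))//.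
rewrite [LHS](ge0_integral_affine (tnth x ord0) s0); last 2 first.
- apply: measurable_funeM.
  pose g (p : T * n.-tuple T) := f (tcons (p.1, affine_tuple x' s p.2)).
  have mg : measurable_fun setT g.
    apply: (measurableT_comp mf); apply: (measurableT_comp (@measurable_tcons R n)).
    apply: measurable_fun_pair => //=.
    exact: (measurableT_comp (measurable_affine_tuple _ _)).
  by have := @measurable_fun_fubini_tonelli_F _ _ _ _ _ (lebesgue_tuple R n) g mg (fun=> f0 _).
- by move=> a; rewrite mule_ge0 ?lee_fin ?exprn_ge0 ?(ltW s0)//; apply: integral_ge0.
under eq_integral => a _.
  under eq_integral => t _ do rewrite -consE.
  over.
rewrite ge0_integralZl//=.
- by rewrite muleA -EFinM exprS.
- have mg : measurable_fun setT ((fun t => f (affine_tuple x s t)) \o @tcons R n).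
    exact: (measurableT_comp mfa (@measurable_tcons R n)).
  by have := @measurable_fun_fubini_tonelli_F _ _ _ _ _ (lebesgue_tuple R n) _ mg (fun=> f0 _).
- by move=> a _; apply: integral_ge0.
- by rewrite lee_fin exprn_ge0// ltW.
Qed.

(** The sigma-algebra on tuples is generated by the coordinates; an open set is
Borel for it because it is the union of the countably many rational boxes that
it contains. *)
Lemma measurable_preimage_row n (U : set 'rV[R]_n) : open U ->
  measurable (@row_of_tuple R n @^-1` U).
Proof.
move=> oU.
pose box (q : n.-tuple rat * rat) : set (n.-tuple T) :=
  \bigcap_(i in [set: 'I_n]) ((@tnth n T ^~ i) @^-1` ball (ratr (tnth q.1 i) : R) (ratr q.2)).
have mbox q : measurable (box q).
  apply: fin_bigcap_measurable => // i _.
  rewrite -[X in measurable X]setTI; apply: measurable_tnth => //.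
  exact: measurable_ball.
pose Q : set (n.-tuple rat * rat) := [set q | box q `<=` @row_of_tuple R n @^-1` U].
rewrite (_ : _ @^-1` U = \bigcup_(q in Q) box q); last first.
  apply/seteqP; split => [t Ut|t [q Qq bq]]; last exact: Qq.
  have /nbhs_ballP[e /= e0 eU] : nbhs (row_of_tuple t) U by exact: open_nbhs_nbhs.
  have [r] := @rat_in_itvoo R 0 (e / 2) ltac:(by rewrite divr_gt0).
  rewrite in_itv/= => /andP[r0 re].
  have /choice[q hq] : forall i : 'I_n, exists q : rat, `|(ratr q : R) - tnth t i| < ratr r.
    move=> i; have [q] := @rat_in_itvoo R (tnth t i - ratr r) (tnth t i + ratr r) ltac:(lra).
    by rewrite in_itv/= => /andP[? ?]; exists q; rewrite ltr_norml; apply/andP; split; lra.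
  (* A box of radius [r < e / 2] around a point within [r] of [t] contains [t] and
     lies in the ball of radius [e] around [t]. *)
  exists ([tuple q i | i < n], r).
    move=> u bu; apply: eU; split => // i j; rewrite !mxE /ball/=.
    have := bu j I; rewrite /= tnth_mktuple /ball/= => h.
    have := hq j.
    rewrite (_ : tnth t j - tnth u j = (ratr (q j) - tnth u j) - (ratr (q j) - tnth t j)); last by ring.
    move=> h'; apply: le_lt_trans (ler_normB _ _) _; lra.
  by move=> i _ /=; rewrite tnth_mktuple /ball/=.
rewrite bigcup_mkcond; apply: countable_bigcupT_measurable => [|q].
  exact: countableP.
by case: ifP => // _; exact: measurable0.
Qed.

Lemma measurable_continuous_row n (f : 'rV[R]_n -> R) : continuous f ->
  measurable_fun setT (fun t : n.-tuple T => f (row_of_tuple t)).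
Proof.
move=> cf; apply: (measurability _ (RGenOpens.measurableE R)).
move=> _ [_ [a [b ->]] <-]; rewrite setTI.
apply: (@measurable_preimage_row _ (f @^-1` `]a, b[)).
by apply: open_comp => [z _|]; [exact: cf|exact: interval_open].
Qed.

Lemma row_affine_tuple n (x : 'rV[R]_n) s (t : n.-tuple T) :
  row_of_tuple (affine_tuple [tuple x 0 i | i < n] s t) = x + s *: row_of_tuple t.
Proof. by apply/rowP => i; rewrite !mxE !tnth_mktuple. Qed.

(** A positive factor respects even the conventional value of an undefined
difference of infinities. *)
Lemma gt0_fin_muleBr (s : R) (x y : \bar R) : 0 < s ->
  (s%:E * (x - y) = s%:E * x - s%:E * y)%E.
Proof.
move=> s0; case: x => [x||]; case: y => [y||] //=;
  rewrite ?(gt0_muley, gt0_muleNy) ?lte_fin//=.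
exact: (congr1 EFin (mulrBr _ _ _)).
Qed.

Lemma fine_gt0_mull (s : R) (x : \bar R) : 0 < s -> fine (s%:E * x) = s * fine x.
Proof.
by move=> s0; case: x => [x||] //; rewrite ?(gt0_muley, gt0_muleNy) ?lte_fin//= mulr0.
Qed.

(** The change of variables [y = x + s z]. It is needed both as a dilation,
to integrate over a fixed ball, and, with [s = 1], as a translation. *)
Lemma eintegral_affine n (x : 'rV[R]_n) (s : R) (D : set 'rV[R]_n) (f : 'rV[R]_n -> R) :
  0 < s -> measurable (@row_of_tuple R n @^-1` D) ->
  measurable_fun setT (fun t : n.-tuple T => f (row_of_tuple t)) ->
  eintegral D f =
  s ^+ n * eintegral [set z | D (x + s *: z)] (fun z => f (x + s *: z)).
Proof.
move=> s0 mD mf; rewrite /eintegral /Rintegral.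
rewrite [X in fine X = _]integral_mkcond [X in _ * fine X]integral_mkcond.
set g := _ \_ _; set h := _ \_ _.
have hE : h = g \o affine_tuple [tuple x 0 i | i < n] s.
  apply/funext => t; rewrite /h /g /= /patch/=.
  suff -> : (t \in [set z | D (x + s *: row_of_tuple z)]) =
    (affine_tuple [tuple x 0 i | i < n] s t \in @row_of_tuple R n @^-1` D).
    by rewrite row_affine_tuple.
  by apply/idP/idP; rewrite !inE/= row_affine_tuple.
have mg : measurable_fun setT g.
  by apply/(measurable_restrictT _ mD); apply: measurable_funTS; exact/measurable_EFinP.
rewrite hE integralE [X in _ = _ * fine X]integralE funepos_comp funeneg_comp /=.
rewrite (@ge0_integral_affine_tuple _ [tuple x 0 i | i < n] s _ s0 (measurable_funepos mg))//.
rewrite [X in (_ - X)%E](@ge0_integral_affine_tuple _ [tuple x 0 i | i < n] s _ s0 (measurable_funeneg mg))//.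
by rewrite -gt0_fin_muleBr ?exprn_gt0// fine_gt0_mull// exprn_gt0.
Qed.

Lemma lebesgue_tuple_box_fin n (M : R) :
  (lebesgue_tuple R n [set t | forall i, (`[(- M)%R, M]%classic : set R) (tnth t i)] < +oo)%E.
Proof.
rewrite (lebesgue_tuple_box (A := fun=> (`[(- M), M]%classic : set R)))//.
rewrite -ge0_fin_numE; last by apply: prode_ge0.
by apply: prode_fin_num => i _; rewrite lebesgue_measure_itv/=; case: ifP.
Qed.

Lemma lebesgue_tuple_bounded_fin n (D : set 'rV[R]_n) (M : R) :
  measurable (@row_of_tuple R n @^-1` D) ->
  (forall z, D z -> forall i, `|z 0 i| <= M) ->
  (lebesgue_tuple R n (@row_of_tuple R n @^-1` D) < +oo)%E.
Proof.
move=> mD DM; apply: le_lt_trans (lebesgue_tuple_box_fin n M).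
apply: le_measure; rewrite ?inE//.
  rewrite (_ : mkset _ = \bigcap_(i in setT) ((@tnth n T ^~ i) @^-1` `[(- M), M]%classic)).
    apply: fin_bigcap_measurable => // i _.
    by rewrite -[X in measurable X]setTI; exact: measurable_tnth.
  by apply/seteqP; split => t /= h i; [move=> _; exact: h|exact: h].
move=> t Dt i /=; rewrite in_itv/=; have := DM _ Dt i.
by rewrite mxE ler_norml.
Qed.

Lemma integrable_bounded_row n (D : set 'rV[R]_n) (M C : R) (f : 'rV[R]_n -> R) :
  measurable (@row_of_tuple R n @^-1` D) ->
  (forall z, D z -> forall i, `|z 0 i| <= M) ->
  measurable_fun setT (fun t : n.-tuple T => f (row_of_tuple t)) ->
  (forall z, D z -> `|f z| <= C) ->
  (lebesgue_tuple R n).-integrable (@row_of_tuple R n @^-1` D)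
    (EFin \o (fun t : n.-tuple T => f (row_of_tuple t))).
Proof.
move=> mD DM mf fC.
apply: measurable_bounded_integrable => //.
- exact: lebesgue_tuple_bounded_fin mD DM.
- exact: measurable_funTS.
- exists C; split; first exact: num_real.
  by move=> C' CC' t Dt; apply: le_trans (fC _ Dt) (ltW CC').
Qed.

End lebesgue_affine.

(** * Radial cutoffs *)
Section cutoff.
Variable R : realType.

(** The square makes the positive part C^1 at the origin. *)
Lemma is_derive_sqr_pospart (t : R) :
  is_derive t 1 (fun s : R => Num.max 0 s ^+ 2) (2 * Num.max 0 t).
Proof.
have [t0|t0|<-] := ltgtP 0 t.
- apply: (@near_eq_is_derive _ _ _ (fun s : R => s ^+ 2)).
    by near=> s; rewrite max_r// ltW//; near: s; exact: lt_nbhsr.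
  have := @exp_derive R 2 t 1; have := @exprn_derivable R 2 t 1.
  by move=> h1 h2; apply: DeriveDef => //; rewrite h2 /= [_%:A]mulr1 expr1.
- rewrite mulr0.
  apply: (@near_eq_is_derive _ _ _ (fun s : R => 0)).
  by near=> s; rewrite max_l ?expr0n// ltW//; near: s; exact: lt_nbhsl.
- rewrite ?maxxx mulr0.
  have H : (fun h : R => h^-1 *: (((fun s : R => Num.max 0 s ^+ 2) \o shift 0) (h *: 1)
      - Num.max 0 0 ^+ 2)) h @[h --> 0^'] --> (0 : R).
    apply/cvgr0Pnorm_le => e e0; near=> h.
    rewrite /= addr0 [h%:A]mulr1 maxxx expr0n subr0 normrZ normfV.
    rewrite normrX expr2 mulrA.
    have hn0 : h != 0 by near: h; exact: nbhs_dnbhs_neq.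
    have hm : `|Num.max 0 h| <= `|h|.
      by have [h0|h0] := lerP 0 h; rewrite ?normr0.
    apply: le_trans (_ : `|h| <= _); last by near: h; apply: dnbhs0_le.
    rewrite -[leRHS]mul1r; apply: ler_pM => //.
    by rewrite ler_pdivrMl ?normr_gt0// mulr1.
  by apply: DeriveDef; [apply/cvg_ex; exists 0|exact: cvg_lim H].
Unshelve. all: by end_near. Qed.

(** Applied to the squared norm, this gives C^1 radial functions, decreasing in
the radius and supported in the closed unit ball, which tend to the indicator of
the open ball as [k] grows. *)
Definition cutoff k (t : R) : R := Num.max 0 (1 - t ^+ k) ^+ 2.

Definition dcutoff k (t : R) : R :=
  - (2 * Num.max 0 (1 - t ^+ k) * (k%:R * t ^+ k.-1)).

Lemma is_derive_cutoff k (t : R) : is_derive t 1 (cutoff k) (dcutoff k t).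
Proof.
have d1 : is_derive t 1 (fun t : R => 1 - t ^+ k) (- (k%:R * t ^+ k.-1)).
  have h : is_derive t (1 : R) (fun t : R => t ^+ k) (k%:R * t ^+ k.-1).
    apply: DeriveDef; first exact: exprn_derivable.
    by rewrite exp_derive [_%:A]mulr1.
  by rewrite -[- _]add0r; apply: is_deriveB.
have d2 := is_derive_sqr_pospart (1 - t ^+ k).
apply: DeriveDef.
  apply/derivable1_diffP.
  apply: (@differentiable_comp _ _ _ _ (fun t : R => 1 - t ^+ k) (fun s : R => Num.max 0 s ^+ 2)).
    by apply/derivable1_diffP; have [] := d1.
  by apply/derivable1_diffP; have [] := d2.
rewrite -derive1E (_ : cutoff k = (fun s : R => Num.max 0 s ^+ 2) \o (fun t : R => 1 - t ^+ k))//.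
rewrite derive1_comp; last 2 first.
- by have [] := d1.
- by have [] := d2.
rewrite !derive1E; have [_ ->] := d1; have [_ ->] := d2.
by rewrite mulrN.
Qed.

Lemma continuous_dcutoff k : continuous (dcutoff k).
Proof.
have ce j : continuous (fun t : R => t ^+ j) by exact: exprn_continuous.
have cm : continuous (fun t : R => Num.max 0 (1 - t ^+ k)).
  move=> t; apply: (@continuous_max R R (fun=> 0) (fun t => 1 - t ^+ k)).
    exact: cvg_cst.
  exact: (cvgB (cvg_cst _) (ce k t)).
move=> t.
exact: (cvgN (cvgM (cvgM (cvg_cst _) (cm t)) (cvgM (cvg_cst _) (ce _ t)))).
Qed.

Lemma derive1_cutoff k : derive1 (cutoff k) = dcutoff k.
Proof. by apply/funext => t; rewrite derive1E; have [_ ->] := is_derive_cutoff k t. Qed.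

Lemma dcutoff_le0 k t : 0 <= t -> dcutoff k t <= 0.
Proof.
by move=> t0; rewrite oppr_le0 !mulr_ge0// ?exprn_ge0// le_max lexx.
Qed.

Lemma cutoff_out k t : 1 <= t -> cutoff k t = 0 /\ dcutoff k t = 0.
Proof.
move=> t1; have m0 : Num.max 0 (1 - t ^+ k) = 0.
  by apply: max_l; rewrite subr_le0 exprn_ege1.
by rewrite /cutoff /dcutoff m0 expr0n mulr0 mul0r oppr0.
Qed.

Lemma cutoff_bound k t : 0 <= t -> 0 <= cutoff k t <= 1.
Proof.
move=> t0; rewrite /cutoff sqr_ge0/= expr_le1//; last by rewrite le_max lexx.
by rewrite ge_max ler01/= gerBl exprn_ge0.
Qed.

Lemma cvg_cutoff t : 0 <= t < 1 -> cutoff k t @[k --> \oo] --> (1 : R).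
Proof.
move=> /andP[t0 t1].
have -> : (fun k => cutoff k t) = (fun k => (1 - t ^+ k) ^+ 2).
  by apply/funext => k; rewrite /cutoff max_r// subr_ge0 exprn_ile1// ltW.
have h : (1 - t ^+ k : R) @[k --> \oo] --> (1 - 0 : R).
  by apply: cvgB; [exact: cvg_cst|apply: cvg_expr; rewrite ger0_norm].
have := cvgM h h; rewrite subr0 mulr1; exact.
Qed.

End cutoff.

(** * Integrals over the unit ball and the divergence inequality *)
Section ball_integral.
Variables (R : realType) (n : nat).
Let T := measurableTypeR R.
Implicit Types (D : set 'rV[R]_n) (f g h : 'rV[R]_n -> R) (x y z : 'rV[R]_n).
Implicit Types (M C : R).

Local Notation B1 := (@eball R n 0 1).
Local Notation sq := (fun z : 'rV[R]_n => \sum_(i < n) z 0 i * z 0 i).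

Lemma eball1E z : B1 z <-> \sum_(i < n) z 0 i * z 0 i < 1.
Proof.
rewrite /eball /= /enorm subr0 -[X in _ < X]sqrtr1 ltr_sqrt//.
Qed.

Lemma C1_sq : C1 sq.
Proof. by move=> z; apply: C1_at_sum => i; apply: C1_atM; exact: C1_at_coord. Qed.

Lemma partial_sq z a : partial a sq z = 2 * z 0 a.
Proof.
rewrite partial_sum => [|i]; last first.
  by apply: differentiableM; exact: differentiable_coord.
rewrite (bigD1 a)//= big1 => [|i ia].
  by rewrite partialM; [rewrite partial_coord eqxx !mulr1 addr0 mulr_natl mulr2n|exact: differentiable_coord..].
by rewrite partialM; [rewrite partial_coord eq_sym (negbTE ia) !mulr0 addr0|exact: differentiable_coord..].
Qed.

Lemma eball1_box z : B1 z -> forall i, `|z 0 i| <= 1.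
Proof.
move=> /eball1E zlt i; rewrite -(@expr_le1 _ 2)//.
rewrite real_normK ?num_real//; apply: le_trans (ltW zlt).
rewrite (bigD1 i)//= -expr2 lerDl sumr_ge0// => j _.
by rewrite -expr2 sqr_ge0.
Qed.

Lemma measurable_eball x (s : R) : 0 < s ->
  measurable (@row_of_tuple R n @^-1` eball x s).
Proof.
move=> s0; pose q (y : 'rV[R]_n) := \sum_(i < n) (y 0 i + - x 0 i) * (y 0 i + - x 0 i).
have Cq : C1 q.
  have Cd i : C1 (fun y : 'rV[R]_n => y 0 i + - x 0 i).
    by move=> y; apply: C1_atD; [exact: C1_at_coord|exact: C1_at_cst].
  by move=> y; apply: C1_at_sum => i; apply: C1_atM; exact: Cd.
have qE y : eball x s y = (q y < s ^+ 2).
  rewrite /eball /= /enorm -[X in _ < X](@gtr0_norm _ s)// -sqrtr_sqr ltr_sqrt ?exprn_gt0//.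
  by under eq_bigr do rewrite !mxE expr2.
rewrite (_ : eball x s = q @^-1` [set t | t < s ^+ 2]).
  apply: measurable_preimage_row; apply: open_comp; last exact: open_lt.
  by move=> z _; exact: C1_cont Cq z.
by apply/seteqP; split => z; rewrite qE.
Qed.

Lemma measurable_eball1 : measurable (@row_of_tuple R n @^-1` B1).
Proof. exact: measurable_eball ltr01. Qed.

Lemma eball_affine x (s : R) : 0 < s -> [set z | eball x s (x + s *: z)] = B1.
Proof.
move=> s0.
have E z : enorm (s *: z) = s * enorm z.
  rewrite /enorm (eq_bigr (fun i => s ^+ 2 * z 0 i ^+ 2)); last first.
    by move=> i _; rewrite mxE exprMn.
  by rewrite -mulr_sumr sqrtrM ?sqr_ge0// sqrtr_sqr gtr0_norm.
have L z : (s * enorm z < s) = (enorm z < 1).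
  by rewrite -[X in _ < X](mulr1 s) ltr_pM2l.
have K z : x + s *: z - x = s *: z by rewrite addrAC subrr add0r.
by apply/seteqP; split => z; rewrite /eball/= subr0 K E L.
Qed.

Lemma continuous_bounded_box f M : continuous f ->
  exists C, forall z, (forall i, `|z 0 i| <= M) -> `|f z| <= C.
Proof.
move=> cf.
have cK : compact [set v : 'rV[R]_n | forall i, v ord0 i \in `[(- M), M]].
  by apply: (@rV_compact _ _ (fun=> `[(- M), M]%classic)) => i; exact: segment_compact.
have : compact (f @` [set v : 'rV[R]_n | forall i, v ord0 i \in `[(- M), M]]).
  by apply: continuous_compact => //; exact: continuous_subspaceT.
move=> /compact_bounded[C [_ HC]]; exists (C + 1) => z zM.
apply: (HC (C + 1)); first by rewrite ltrDl.
by exists z => // i; rewrite in_itv/= -ler_norml; exact: zM.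
Qed.

Lemma integrable_continuous D M f :
  measurable (@row_of_tuple R n @^-1` D) ->
  (forall z, D z -> forall i, `|z 0 i| <= M) -> continuous f ->
  (lebesgue_tuple R n).-integrable (@row_of_tuple R n @^-1` D)
    (EFin \o (fun t : n.-tuple T => f (row_of_tuple t))).
Proof.
move=> mD DM cf; have [C fC] := continuous_bounded_box M cf.
apply: (integrable_bounded_row (C := C) mD DM).
  exact: measurable_continuous_row.
by move=> z /DM; exact: fC.
Qed.

Lemma integrable_eball1 f : continuous f ->
  (lebesgue_tuple R n).-integrable (@row_of_tuple R n @^-1` B1)
    (EFin \o (fun t : n.-tuple T => f (row_of_tuple t))).
Proof. exact: integrable_continuous measurable_eball1 eball1_box. Qed.

Lemma continuous_sum m (F : 'I_m -> 'rV[R]_n -> R) :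
  (forall i, continuous (F i)) -> continuous (fun z => \sum_(i < m) F i z).
Proof. by move=> cF y; apply: continuous_at_sum => i; exact: cF. Qed.

(** Differentiation under the integral sign along lines [s |-> A z + s B z]. The
choice [A = x], [B = id] differentiates a dilation, and [A = id], [B = e_a] a
translation. *)
Lemma derive_eintegral_line D M (A B : 'rV[R]_n -> 'rV[R]_n) g (s0 : R) :
  measurable (@row_of_tuple R n @^-1` D) ->
  (forall z, D z -> forall i, `|z 0 i| <= M) ->
  continuous A -> continuous B -> C1 g ->
  is_derive s0 1 (fun s => eintegral D (fun z => g (A z + s *: B z)))
    (eintegral D (fun z => \sum_(b < n) B z 0 b * partial b g (A z + s0 *: B z))).
Proof.
move=> mD DM cA cB Cg.
pose f (s : R) (t : n.-tuple T) := g (A (row_of_tuple t) + s *: B (row_of_tuple t)).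
have cAB s : continuous (fun z => A z + s *: B z).
  move=> z; have csB : {for z, continuous (fun z => s *: B z)}.
    exact: (continuous_comp (cB z) (@scaler_continuous _ _ s _)).
  exact: (cvgD (cA z) csB).
have cgAB (h : 'rV[R]_n -> R) s : continuous h -> continuous (fun z => h (A z + s *: B z)).
  by move=> ch z; exact: (continuous_comp (cAB s z) (ch _)).
have cBi b : continuous (fun z => B z 0 b).
  by move=> z; exact: (continuous_comp (cB z) (@coord_continuous _ _ _ _ _ _)).
have cAi b : continuous (fun z => A z 0 b).
  by move=> z; exact: (continuous_comp (cA z) (@coord_continuous _ _ _ _ _ _)).
have d1 (s : R) (t : n.-tuple T) : is_derive s (1 : R) (f ^~ t) (\sum_(b < n) B (row_of_tuple t) 0 b *
    partial b g (A (row_of_tuple t) + s *: B (row_of_tuple t))).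
  rewrite -derive_rowE; last exact: C1_diff.
  by apply: is_derive_line; exact: C1_diff.
have d1E s t : partial1of2 f s t = \sum_(b < n) B (row_of_tuple t) 0 b *
    partial b g (A (row_of_tuple t) + s *: B (row_of_tuple t)).
  by rewrite /partial1of2 derive1E; have [_ ->] := d1 s t.
have /choice[a aP] : forall b, exists c, forall z, (forall i, `|z 0 i| <= M) -> `|A z 0 b| <= c.
  by move=> b; exact: continuous_bounded_box.
have /choice[c cP] : forall b, exists c, forall z, (forall i, `|z 0 i| <= M) -> `|B z 0 b| <= c.
  by move=> b; exact: continuous_bounded_box.
(* [N] bounds all coordinates of [A z + s *: B z] for [z] in [D] and
   [s] within distance 1 of [s0]; the maximum over the coordinates is replaced
   by their sum. *)
pose N := \sum_(i < n) (`|a i| + (`|s0| + 1) * `|c i|).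
have /choice[C CP] : forall b, exists c, forall z, (forall i, `|z 0 i| <= N) -> `|partial b g z| <= c.
  by move=> b; apply: continuous_bounded_box; exact: C1_partial_cont.
pose G : n.-tuple T -> R := fun=> \sum_(b < n) `|c b| * `|C b|.
have Gub s t : `]s0 - 1, s0 + 1[%classic s -> (@row_of_tuple R n @^-1` D) t ->
    `|partial1of2 f s t| <= G t.
  move=> /=; rewrite in_itv/= => /andP[s1 s2] Dt; rewrite d1E.
  have tM := DM _ Dt.
  have ss : `|s| <= `|s0| + 1.
    rewrite -[s](subrK s0) addrC; apply: le_trans (ler_normD _ _) _.
    by rewrite lerD2l ler_norml; apply/andP; split; lra.
  apply: le_trans (ler_norm_sum _ _ _) _; apply: ler_sum => b _.
  rewrite normrM; apply: ler_pM => //.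
    by apply: le_trans (ler_norm _); exact: cP.
  apply: le_trans (ler_norm _); apply: CP => i; rewrite !mxE.
  apply: le_trans (ler_normD _ _) _; rewrite normrM.
  have -> : N = (`|a i| + (`|s0| + 1) * `|c i|) +
    \sum_(j < n | j != i) (`|a j| + (`|s0| + 1) * `|c j|) by rewrite /N (bigD1 i).
  rewrite -[leLHS]addr0; apply: lerD.
    apply: lerD; first by apply: le_trans (ler_norm _); exact: aP.
    by apply: ler_pM => //; apply: le_trans (ler_norm _); exact: cP.
  by apply: sumr_ge0 => j _; rewrite addr_ge0// mulr_ge0// addr_ge0.
have intf s : `]s0 - 1, s0 + 1[%classic s ->
    (lebesgue_tuple R n).-integrable (@row_of_tuple R n @^-1` D) (EFin \o f s).
  move=> _; apply: (integrable_continuous (f := fun z => g (A z + s *: B z)) mD DM).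
  by apply: cgAB; exact: C1_cont.
have intG : (lebesgue_tuple R n).-integrable (@row_of_tuple R n @^-1` D) (EFin \o G).
  apply: (integrable_continuous (f := fun=> \sum_(b < n) `|c b| * `|C b|) mD DM).
  by move=> z; exact: C1_at_cont (C1_at_cst z _).
have G0 t : 0 <= G t by rewrite /G; apply: sumr_ge0 => b _; rewrite mulr_ge0.
have Is0 : `]s0 - 1, s0 + 1[%classic s0 by rewrite /= in_itv/= ltrDl gtrBl ltr01.
have derf s t : `]s0 - 1, s0 + 1[%classic s -> (@row_of_tuple R n @^-1` D) t ->
  derivable (f ^~ t) s 1 by move=> _ _; have [] := d1 s t.
have h1 := derivable_under_integral mD Is0 intf derf G0 intG Gub.
have h2 := differentiation_under_integral mD Is0 intf derf G0 intG Gub.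
apply: DeriveDef; first exact: h1.
rewrite -derive1E; etransitivity; first exact: h2.
rewrite /eintegral; apply: eq_Rintegral => t _.
exact: d1E.
Qed.

Lemma eintegral_support D f : (forall z, ~ D z -> f z = 0) ->
  eintegral D f = eintegral setT f.
Proof.
move=> fD; rewrite /eintegral Rintegral_mkcond preimage_setT.
apply: eq_Rintegral => t _; rewrite /patch; case: ifPn => //.
by rewrite notin_setE => /= nD; rewrite fD.
Qed.

Lemma eq_eintegral D f g : (forall z, D z -> f z = g z) -> eintegral D f = eintegral D g.
Proof. by move=> fg; apply: eq_Rintegral => t; rewrite inE => /= Dt; exact: fg. Qed.

Lemma eintegral1D f g : continuous f -> continuous g ->
  eintegral B1 (fun z => f z + g z) = eintegral B1 f + eintegral B1 g.
Proof.
move=> cf cg; apply: RintegralD; first exact: measurable_eball1.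
  exact: integrable_eball1 cf.
exact: integrable_eball1 cg.
Qed.

Lemma eintegral1Z f k : continuous f ->
  eintegral B1 (fun z => k * f z) = k * eintegral B1 f.
Proof.
by move=> cf; apply: RintegralZl; [exact: measurable_eball1|exact: integrable_eball1 cf].
Qed.

Lemma eintegral1_sum m (F : 'I_m -> 'rV[R]_n -> R) : (forall i, continuous (F i)) ->
  eintegral B1 (fun z => \sum_(i < m) F i z) = \sum_(i < m) eintegral B1 (F i).
Proof.
elim: m F => [|m IH] F cF.
  rewrite big_ord0 (@eq_eintegral _ _ (fun z => 0 * 0)); last first.
    by move=> z _; rewrite big_ord0 mulr0.
  by rewrite eintegral1Z ?mul0r// => z; exact: C1_at_cont (C1_at_cst z _).
rewrite big_ord_recr/= -IH// -eintegral1D//; last exact: continuous_sum.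
by apply: eq_eintegral => z _; rewrite big_ord_recr.
Qed.

Lemma le_eintegral1 f g : continuous f -> continuous g ->
  (forall z, B1 z -> f z <= g z) -> eintegral B1 f <= eintegral B1 g.
Proof.
move=> cf cg fg; apply: le_Rintegral; first exact: measurable_eball1.
- exact: integrable_eball1 cf.
- exact: integrable_eball1 cg.
- by move=> t Dt; exact: fg.
Qed.

Lemma eintegral_translate h x : continuous h ->
  eintegral setT (fun z => h (z + x)) = eintegral setT h.
Proof.
move=> ch; rewrite (eintegral_affine x (D := setT) (f := h) ltr01).
- rewrite expr1n mul1r (_ : [set z | _] = setT); last by apply/seteqP.
  by apply: eq_eintegral => z _; rewrite scale1r addrC.
- by rewrite preimage_setT.
- exact: measurable_continuous_row.
Qed.

(** Translation invariance of the integral, differentiated: the integral of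
[h (z + s *: e_a)] does not depend on [s]. *)
Lemma eintegral_partial0 (a : 'I_n) h : C1 h ->
  (forall z, ~ B1 z -> h z = 0) -> (forall z, ~ B1 z -> partial a h z = 0) ->
  eintegral B1 (partial a h) = 0.
Proof.
move=> Ch h0 dh0.
(* A bounded domain large enough to contain the support of [h] after a
   translation by less than 1; it is a cube, as the norm is the sup norm. *)
pose Q := ball (0 : 'rV[R]_n) 3.
have Qbox z : Q z <-> forall i, `|z 0 i| < 3.
  rewrite /Q /ball/=; split => [[_ zQ] i|zQ].
    by have := zQ 0 i; rewrite /ball/= mxE sub0r normrN.
  by split => // i j; rewrite /ball/= mxE sub0r normrN ord1.
have B1Q z : ~ Q z -> ~ B1 z.
  move=> nQ /eball1_box zB; apply/nQ/Qbox => i; apply: le_lt_trans (zB i) _; lra.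
have mQ : measurable (@row_of_tuple R n @^-1` Q).
  by apply: measurable_preimage_row; exact: ball_open.
have QM z : Q z -> forall i, `|z 0 i| <= 3 by move=> /Qbox zQ i; exact: ltW.
have cid : continuous (id : 'rV[R]_n -> 'rV[R]_n) by move=> z; exact: cvg_id.
have ccst : continuous ((fun=> delta_mx 0 a) : 'rV[R]_n -> 'rV[R]_n).
  by move=> z; exact: (differentiable_continuous (differentiable_cst (delta_mx 0 a : 'rV[R]_n) z)).
have [_ dF] := @derive_eintegral_line Q 3 id (fun=> delta_mx 0 a) h 0 mQ QM cid ccst Ch.
have cst_F (s : R) : `|s| < 1 ->
    eintegral Q (fun z => h (z + s *: delta_mx 0 a)) = eintegral setT h.
  move=> s1; rewrite eintegral_support; first by rewrite eintegral_translate//; exact: C1_cont.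
  move=> z nQ; apply: h0 => /eball1_box zB; apply/nQ/Qbox => i.
  have := zB i; rewrite !mxE eqxx/=; move: s1; rewrite !ltr_norml !ler_norml.
  by case: (i == a); rewrite /= ?mulr1n ?mulr0n ?mulr1 ?mulr0 => /andP[? ?] /andP[? ?]; apply/andP; split; lra.
rewrite eintegral_support// -(eintegral_support (D := Q)); last first.
  by move=> z /B1Q; exact: dh0.
rewrite (@eq_eintegral _ _ (fun z => \sum_(b < n) (delta_mx 0 a : 'rV[R]_n) 0 b *
   partial b h (z + 0 *: delta_mx 0 a))); last first.
  move=> z _; rewrite (bigD1 a)//= big1 => [|b ba].
    by rewrite mxE !eqxx mul1r addr0 scale0r addr0.
  by rewrite mxE eqxx (negbTE ba) mul0r.
rewrite -dF; transitivity ('D_1 (cst (eintegral setT h) : R -> R) (0 : R)); last first.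
  exact: derive_cst.
have N : \forall s \near (0 : R), `|s| < 1 by exact: nbhs0_lt.
have N' : \forall s \near (0 : R),
    eintegral Q (fun z => h (z + s *: delta_mx 0 a)) = eintegral setT h.
  by near=> s; apply: cst_F; near: s.
exact: (@near_eq_derive R R R _ _ 0 1 N').
Unshelve. all: by end_near. Qed.

Lemma continuousM_fun f g : continuous f -> continuous g -> continuous (fun z => f z * g z).
Proof. by move=> cf cg z; exact: (cvgM (cf z) (cg z)). Qed.

Lemma continuousD_fun f g : continuous f -> continuous g -> continuous (fun z => f z + g z).
Proof. by move=> cf cg z; exact: (cvgD (cf z) (cg z)). Qed.

Lemma sq_ge0 z : 0 <= sq z.
Proof. by apply: sumr_ge0 => i _; rewrite -expr2 sqr_ge0. Qed.

Lemma C1_cutoff k : C1 (fun z => cutoff k (sq z)).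
Proof.
move=> z; apply: C1_at_comp1; first exact: C1_sq.
  by move=> t; have [] := is_derive_cutoff k t.
by rewrite derive1_cutoff; exact: continuous_dcutoff.
Qed.

(** With [h a = cutoff * X a], the integral of [sum_a d_a (h a)] vanishes. By the
product rule it is the integral below plus that of
[2 * dcutoff * sum_a X a z * z_a], which is nonpositive because the cutoff
decreases and [X] points outwards. *)
Lemma eintegral_cutoff_div_ge0 k (X : 'I_n -> 'rV[R]_n -> R) :
  (forall a, C1 (X a)) -> (forall z, 0 <= \sum_(a < n) X a z * z 0 a) ->
  0 <= eintegral B1 (fun z => cutoff k (sq z) * \sum_(a < n) partial a (X a) z).
Proof.
move=> CX X0.
pose h a z := cutoff k (sq z) * X a z.
have Ch a : C1 (h a) by move=> z; apply: C1_atM; [exact: C1_cutoff|exact: CX].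
have ph a z : partial a (h a) z = cutoff k (sq z) * partial a (X a) z +
    X a z * (dcutoff k (sq z) * (2 * z 0 a)).
  rewrite partialM; [|exact: C1_diff (C1_cutoff k) z|exact: C1_diff (CX a) z].
  rewrite partial_comp1; [|exact: C1_diff C1_sq z|by have [] := is_derive_cutoff k (sq z)].
  by rewrite derive1_cutoff partial_sq.
have out z : ~ B1 z -> 1 <= sq z.
  by move=> nz; rewrite leNgt; apply/negP => /eball1E.
have h0 a : eintegral B1 (partial a (h a)) = 0.
  apply: eintegral_partial0 => // z /out/(cutoff_out k)[c0 c0'].
    by rewrite /h c0 mul0r.
  by rewrite ph c0 c0' !mul0r mulr0 addr0.
have cp a : continuous (partial a (h a)) by exact: C1_partial_cont.
have E0 : eintegral B1 (fun z => \sum_(a < n) partial a (h a) z) = 0.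
  by rewrite eintegral1_sum// big1.
rewrite -[leLHS]E0.
apply: le_eintegral1.
- exact: continuous_sum.
- apply: continuousM_fun; first exact: C1_cont (C1_cutoff k).
  by apply: continuous_sum => a; exact: C1_partial_cont.
move=> z _; under eq_bigr do rewrite ph.
rewrite big_split/= -mulr_sumr gerDl.
rewrite (eq_bigr (fun a => (2 * dcutoff k (sq z)) * (X a z * z 0 a))); last first.
  by move=> a _; ring.
rewrite -mulr_sumr mulr_le0_ge0// pmulr_rle0//.
exact: dcutoff_le0 (sq_ge0 z).
Qed.

(** The sign of the flux in the divergence theorem, obtained by letting the cutoff
tend to the indicator of the ball under dominated convergence. *)
Lemma eintegral_div_ge0 (X : 'I_n -> 'rV[R]_n -> R) :
  (forall a, C1 (X a)) -> (forall z, 0 <= \sum_(a < n) X a z * z 0 a) ->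
  0 <= eintegral B1 (fun z => \sum_(a < n) partial a (X a) z).
Proof.
move=> CX X0.
pose dX z := \sum_(a < n) partial a (X a) z.
have cdX : continuous dX by apply: continuous_sum => a; exact: C1_partial_cont.
have cc k : continuous (fun z => cutoff k (sq z) * dX z).
  by apply: continuousM_fun => //; exact: C1_cont (C1_cutoff k).
have mB := measurable_eball1.
have int_dX := integrable_eball1 cdX.
have lim : eintegral B1 (fun z => cutoff k (sq z) * dX z) @[k --> \oo] --> eintegral B1 dX.
  apply: fine_cvg; rewrite fineK; last exact: integrable_fin_num int_dX.
  apply: (@dominated_cvg _ _ _ (lebesgue_tuple R n) _ _ _ _
    (fun t => `|dX (row_of_tuple t)|%:E)) => //.
  - by move=> k; have /integrableP[] := integrable_eball1 (cc k).
  - move=> t Bt; apply: cvg_EFin; first by near=> k.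
    have /cvg_cutoff h : 0 <= sq (row_of_tuple t) < 1.
      by rewrite sq_ge0/=; exact/eball1E.
    by rewrite -[X in _ --> X]mul1r; exact: (cvgM h (cvg_cst _)).
  - by have := integrable_abse int_dX.
  - move=> k t Bt; rewrite lee_fin normrM ler_piMl//.
    by have /andP[c0 c1] := cutoff_bound k (sq_ge0 (row_of_tuple t)); rewrite ger0_norm.
rewrite -/dX -(cvg_lim _ lim)//; apply: limr_ge; first by apply/cvg_ex; eexists; exact: lim.
by near=> k; exact: eintegral_cutoff_div_ge0.
Unshelve. all: by end_near. Qed.

Section affine.
Variables (x : 'rV[R]_n) (r : R).
Let u z := x + r *: z.

Lemma differentiable_affine z : differentiable u z.
Proof. by apply: differentiableD => //; apply: differentiableZ. Qed.

Lemma C1_affine g : C1 g -> C1 (fun z => g (x + r *: z)).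
Proof.
move=> Cg z; apply: (@C1_at_comp _ _ _ _ u); last exact: Cg.
  by near=> w; exact: differentiable_affine.
move=> i; rewrite (_ : (fun z => _) = fun z : 'rV[R]_n => x 0 i + r * z 0 i).
  apply: C1_atD; first exact: C1_at_cst.
  by apply: C1_atM; [exact: C1_at_cst|exact: C1_at_coord].
by apply/funext => w; rewrite !mxE.
Unshelve. all: by end_near. Qed.

Lemma partial_affine g a z : C1 g ->
  partial a (fun z => g (x + r *: z)) z = r * partial a g (x + r *: z).
Proof.
move=> Cg; rewrite (@partial_comp _ _ _ u); last 2 first.
- exact: differentiable_affine.
- exact: C1_diff.
have E l : partial a u z 0 l = r * (a == l)%:R.
  rewrite partial_entry; last exact: differentiable_affine.
  rewrite (_ : (fun z => _) = fun z : 'rV[R]_n => x 0 l + r * z 0 l); last first.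
    by apply/funext => w; rewrite !mxE.
  have dl := differentiable_coord z 0 l.
  have dr := C1_diff (fun y => C1_at_cst y r) z.
  rewrite partialD; [|exact: C1_diff (fun y => C1_at_cst y _) z|exact: differentiableM].
  by rewrite partialM// !partial_cst partial_coord add0r mulr0 addr0.
rewrite (bigD1 a)//= big1 => [|b ba].
  by rewrite E eqxx mulr1 addr0 mulrC.
by rewrite E eq_sym (negbTE ba) !mulr0.
Qed.

End affine.

End ball_integral.

(** * Monotonicity for a conserved tensor *)
Section monotonicity.
Variables (R : realType) (n : nat).

(** The third hypothesis says that [S a b - e * delta_ab] is divergence free; for a
map with potential this is, up to sign, the stress-energy tensor. The trace bound
plays the part of the sign of the potential. *)
Theorem stress_energy_monotonicity (e : 'rV[R]_n -> R) (S : 'I_n -> 'I_n -> 'rV[R]_n -> R)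
    (x : 'rV[R]_n) (r : R) :
  C1 e -> (forall a b, C1 (S a b)) ->
  (forall b y, partial b e y = \sum_(a < n) partial a (S a b) y) ->
  (forall y, \sum_(a < n) S a a y <= 2 * e y) ->
  (forall y z : 'rV[R]_n, 0 <= \sum_(a < n) \sum_(b < n) z 0 a * z 0 b * S a b y) ->
  0 < r ->
  let F := fun s : R => (s ^ (n%:Z - 2))^-1 * eintegral (eball x s) e in
  derivable F r 1 /\ 0 <= derive1 F r.
Proof.
move=> Ce CS dive trS psdS r0 F.
pose J (s : R) := eintegral (eball 0 1) (fun z => e (x + s *: z)).
pose dJ := eintegral (eball 0 1) (fun z : 'rV[R]_n => \sum_(b < n) z 0 b * partial b e (x + r *: z)).
have FE (s : R) : 0 < s -> F s = s ^+ 2 * J s.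
  move=> s0; rewrite /F (eintegral_affine x s0); last 2 first.
  - exact: measurable_eball.
  - by apply: measurable_continuous_row; exact: C1_cont.
  rewrite eball_affine// mulrA; congr (_ * _).
  have sn0 : s != 0 by rewrite gt_eqF.
  apply: (mulfI (expfz_neq0 (n%:Z - 2) sn0)).
  rewrite mulrA divff ?expfz_neq0// mul1r !exprnP -expfzDr//.
  by rewrite subrK.
have dJr : is_derive r 1 J dJ.
  apply: (@derive_eintegral_line R n (eball 0 1) 1 (fun=> x) id e r) => //.
  - exact: measurable_eball1.
  - exact: eball1_box.
  - by move=> z; exact: (differentiable_continuous (differentiable_cst x z)).
  - by move=> z; exact: cvg_id.
have dFr : is_derive r 1 F (r ^+ 2 * dJ + J r * (2 * r)).
  have nE : \forall s \near r, s ^+ 2 * J s = F s.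
    by near=> s; rewrite FE//; near: s; exact: lt_nbhsr.
  apply: (@near_eq_is_derive R R R (fun s => s ^+ 2 * J s) F r 1 _ nE).
  have h : is_derive r (1 : R) (fun t : R => t ^+ 2) (2 * r).
    apply: DeriveDef; first exact: exprn_derivable.
    by rewrite exp_derive [_%:A]mulr1 expr1.
  exact: is_deriveM.
have [dF1 dF2] := dFr; split => //.
rewrite derive1E dF2.
(* The radial contraction of [S], whose divergence is the part of the
   integrand that the trace bound leaves. *)
pose X (a : 'I_n) (z : 'rV[R]_n) := \sum_(b < n) z 0 b * S a b (x + r *: z).
have CX a : C1 (X a).
  move=> z; apply: C1_at_sum => b; apply: C1_atM; first exact: C1_at_coord.
  exact: (@C1_affine _ _ x r _ (CS a b) z).
have X0 z : 0 <= \sum_(a < n) X a z * z 0 a.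
  rewrite (eq_bigr (fun a => \sum_(b < n) z 0 a * z 0 b * S a b (x + r *: z)))//.
  by move=> a _; rewrite /X mulr_suml; apply: eq_bigr => b _; ring.
have pX z : \sum_(a < n) partial a (X a) z =
    \sum_(a < n) S a a (x + r *: z) + r * \sum_(b < n) z 0 b * partial b e (x + r *: z).
  have E a : partial a (X a) z = S a a (x + r *: z) +
      \sum_(b < n) r * (z 0 b * partial a (S a b) (x + r *: z)).
    rewrite partial_sum; last first.
      by move=> b; apply: C1_diff z => w; apply: C1_atM; [exact: C1_at_coord|exact: (@C1_affine _ _ x r _ (CS a b) w)].
    under eq_bigr => b _.
      rewrite partialM; [|exact: differentiable_coord|exact: C1_diff (@C1_affine _ _ x r _ (CS a b)) z].
      rewrite partial_affine// partial_coord.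
      over.
    rewrite big_split/= addrC; congr (_ + _); last first.
      by apply: eq_bigr => b _; ring.
    rewrite (bigD1 a)//= eqxx mulr1 big1 ?addr0// => b ba.
    by rewrite eq_sym (negbTE ba) mulr0.
  under eq_bigr do rewrite E.
  rewrite big_split/=; congr (_ + _); rewrite mulr_sumr exchange_big/=.
  by apply: eq_bigr => b _; rewrite dive -!mulr_sumr.
have div0 := eintegral_div_ge0 CX X0.
have cb b : continuous (fun z : 'rV[R]_n => z 0 b * partial b e (x + r *: z)).
  apply: continuousM_fun; first by move=> z; exact: C1_at_cont (C1_at_coord z b).
  move=> z; exact: (continuous_comp (differentiable_continuous (differentiable_affine x r z))
    (@C1_partial_cont _ _ _ b Ce _)).
have ce : continuous (fun z : 'rV[R]_n => e (x + r *: z)).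
  by move=> z; apply: C1_at_cont; exact: (@C1_affine _ _ x r _ Ce z).
have cs : continuous (fun z : 'rV[R]_n => \sum_(b < n) z 0 b * partial b e (x + r *: z)).
  exact: continuous_sum.
have ck (k : R) (f : 'rV[R]_n -> R) : continuous f -> continuous (fun z : 'rV[R]_n => k * f z).
  by move=> cf; apply: continuousM_fun => // z; exact: C1_at_cont (C1_at_cst z _).
have : 0 <= 2 * J r + r * dJ.
  apply: le_trans div0 _; rewrite -eintegral1Z// -eintegral1Z//.
  rewrite -eintegral1D; [|exact: ck|exact: ck].
  apply: le_eintegral1.
  - by apply: continuous_sum => a; exact: C1_partial_cont.
  - by apply: continuousD_fun; exact: ck.
  by move=> z _; rewrite pX lerD2r.
move=> h; rewrite (_ : _ + _ = r * (2 * J r + r * dJ)); last by rewrite /GRing.scale/=; ring.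
by rewrite mulr_ge0// ltW.
Unshelve. all: by end_near. Qed.

End monotonicity.

(** * The conservation law at a point *)
Section algebra.
Variables (R : realType) (m n : nat).
Variables (g ginv : 'I_m -> 'I_m -> R) (dg : 'I_m -> 'I_m -> 'I_m -> R).
Variables (w : 'I_n -> 'I_m -> R) (h : 'I_n -> 'I_n -> 'I_m -> R) (dv : 'I_m -> R).

(** The derivative in the direction [e_c] of the inner product
[<dphi(e_a), dphi(e_b)>], written with the components [g] of the metric,
their derivatives [dg], the components [w] and [h] of the first and second
derivatives of the map in a chart. *)
Definition dmetric_inner (c a b : 'I_n) : R := \sum_(i < m) \sum_(j < m)
  (h c a i * g i j * w b j + w a i * (\sum_(l < m) dg l i j * w c l) * w b j
   + w a i * g i j * h c b j).

Hypothesis g_sym : forall i j, g i j = g j i.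
Hypothesis h_sym : forall a b i, h a b i = h b a i.
Hypothesis g_ginv : forall p l, \sum_(k < m) g p k * ginv k l = (p == l)%:R.
Hypothesis harm : forall k, \sum_(a < n) (h a a k + \sum_(i < m) \sum_(j < m)
    (2^-1 * \sum_(l < m) ginv k l * (dg i j l + dg j i l - dg l i j)) * w a i * w a j)
  = - \sum_(l < m) ginv k l * dv l.

(** [Y a l / 2] is the Christoffel term of the tension field in the direction
[e_a], with its index lowered. *)
Let Y a l := \sum_(i < m) \sum_(j < m) (dg i j l + dg j i l - dg l i j) * w a i * w a j.

Let lower p (X : 'I_m -> R) : \sum_(k < m) g p k * (\sum_(l < m) ginv k l * X l) = X p.
Proof.
under eq_bigr do rewrite mulr_sumr.
rewrite exchange_big/= (bigD1 p)//= [X in _ + X]big1 => [|l lp].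
  by under eq_bigr do rewrite mulrA; rewrite -mulr_suml g_ginv eqxx mul1r addr0.
by under eq_bigr do rewrite mulrA; rewrite -mulr_suml g_ginv eq_sym (negbTE lp) mul0r.
Qed.

Let laplace k : \sum_(a < n) h a a k =
  \sum_(l < m) ginv k l * - (dv l + 2^-1 * \sum_(a < n) Y a l).
Proof.
have := harm k; rewrite big_split/= => /eqP.
rewrite -subr_eq0 opprK addrAC addr_eq0 => /eqP H.
have -> : \sum_(a < n) h a a k = - (\sum_(l < m) ginv k l * dv l
   + \sum_(l < m) ginv k l * (2^-1 * \sum_(a < n) Y a l)).
  apply/eqP; rewrite -addr_eq0 addrA H; apply/eqP; rewrite addrC; apply/eqP.
  rewrite subr_eq0; apply/eqP.
  under [LHS]eq_bigr do rewrite mulrCA mulr_sumr mulr_sumr.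
  rewrite [LHS]exchange_big/=; apply: eq_bigr => a _.
  rewrite /Y; under [LHS]eq_bigr do rewrite mulr_sumr mulr_sumr.
  rewrite [LHS]exchange_big/=; apply: eq_bigr => i _.
  under [LHS]eq_bigr do rewrite mulr_sumr mulr_sumr.
  rewrite [LHS]exchange_big/=; apply: eq_bigr => j _.
  by rewrite mulr_sumr !mulr_suml; apply: eq_bigr => l _; ring.
rewrite -big_split/= -sumrN; apply: eq_bigr => l _; ring.
Qed.

Let lowered_laplace p : \sum_(i < m) g p i * \sum_(a < n) h a a i =
  - (dv p + 2^-1 * \sum_(a < n) Y a p).
Proof. by under eq_bigr do rewrite laplace; rewrite lower. Qed.

(** The three terms of the product rule; those with second derivatives are put in
the form in which the lowered Laplacian can be substituted. *)
Lemma dmetric_inner_split c a b : dmetric_inner c a b =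
  \sum_(j < m) w b j * (\sum_(i < m) g j i * h c a i) +
  (\sum_(i < m) \sum_(j < m) \sum_(l < m) dg l i j * w a i * w b j * w c l +
  \sum_(j < m) w a j * (\sum_(i < m) g j i * h c b i)).
Proof.
rewrite /dmetric_inner.
under eq_bigr do rewrite big_split big_split/=.
rewrite !big_split/= -addrA; congr (_ + (_ + _)).
- rewrite exchange_big/=; apply: eq_bigr => j _.
  by rewrite mulr_sumr; apply: eq_bigr => i _; rewrite (g_sym j i); ring.
- apply: eq_bigr => i _; apply: eq_bigr => j _.
  by rewrite mulr_sumr mulr_suml; apply: eq_bigr => l _; ring.
- by apply: eq_bigr => i _; rewrite mulr_sumr; apply: eq_bigr => j _; ring.
Qed.

(** On the left the second derivatives are [h b a], on the right [h a a] and
[h a b]. The mixed ones agree by symmetry; the Laplacian on the right is replaced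
by means of the equation, and its Christoffel term cancels the derivatives of the
metric, which [P] and [Q] collect. *)
Lemma dmetric_inner_conservation b :
  2^-1 * (\sum_(a < n) dmetric_inner b a a) - \sum_(l < m) dv l * w b l =
  \sum_(a < n) dmetric_inner a a b.
Proof.
pose P a := \sum_(i < m) \sum_(j < m) \sum_(l < m) dg l i j * w a i * w a j * w b l.
pose Q a := \sum_(i < m) \sum_(j < m) \sum_(l < m) dg l i j * w a i * w b j * w a l.
pose H a := \sum_(j < m) w a j * (\sum_(i < m) g j i * h a b i).
have L a : dmetric_inner b a a = P a + 2 * H a.
  rewrite dmetric_inner_split -/(P a).
  have -> : \sum_(j < m) w a j * (\sum_(i < m) g j i * h b a i) = H a.
    by apply: eq_bigr => j _; congr (_ * _); apply: eq_bigr => i _; rewrite h_sym.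
  by ring.
have Rh a : dmetric_inner a a b = \sum_(j < m) w b j * (\sum_(i < m) g j i * h a a i) + (Q a + H a).
  by rewrite dmetric_inner_split.
(* Renaming the summation indices: the first two terms of a Christoffel symbol
   each contribute [Q a]. *)
have YE a : \sum_(l < m) w b l * Y a l = 2 * Q a - P a.
  have -> : P a = \sum_(l < m) w b l * \sum_(i < m) \sum_(j < m) dg l i j * w a i * w a j.
    rewrite /P; under eq_bigr do rewrite exchange_big/=.
    rewrite exchange_big/=; apply: eq_bigr => l _.
    rewrite mulr_sumr; apply: eq_bigr => i _; rewrite mulr_sumr.
    by apply: eq_bigr => j _; ring.
  have Q1 : Q a = \sum_(l < m) w b l * \sum_(i < m) \sum_(j < m) dg i j l * w a i * w a j.
    rewrite /Q exchange_big/=; apply: eq_bigr => l _.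
    rewrite exchange_big/= mulr_sumr; apply: eq_bigr => i _; rewrite mulr_sumr.
    by apply: eq_bigr => j _; ring.
  have Q2 : Q a = \sum_(l < m) w b l * \sum_(i < m) \sum_(j < m) dg j i l * w a i * w a j.
    rewrite Q1; apply: eq_bigr => l _; congr (_ * _).
    by rewrite exchange_big/=; apply: eq_bigr => i _; apply: eq_bigr => j _; ring.
  rewrite (_ : 2 * Q a = Q a + Q a); last by ring.
  rewrite {1}Q1 Q2 -big_split/= -sumrB; apply: eq_bigr => l _.
  rewrite -mulrDr -mulrBr; congr (_ * _); rewrite /Y -big_split/= -sumrB.
  apply: eq_bigr => i _; rewrite -big_split/= -sumrB.
  by apply: eq_bigr => j _; ring.
under eq_bigr do rewrite L; under [RHS]eq_bigr do rewrite Rh.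
rewrite !big_split/= -mulr_sumr.
have -> : \sum_(a < n) \sum_(j < m) w b j * (\sum_(i < m) g j i * h a a i) =
    - (\sum_(l < m) dv l * w b l + 2^-1 * \sum_(a < n) (2 * Q a - P a)).
  have -> : \sum_(a < n) (2 * Q a - P a) = \sum_(a < n) \sum_(l < m) w b l * Y a l.
    by apply: eq_bigr => a _; rewrite YE.
  rewrite [in RHS]exchange_big/= mulr_sumr -big_split/= -sumrN exchange_big/=.
  apply: eq_bigr => j _; rewrite -mulr_sumr exchange_big/=.
  under eq_bigr do rewrite -mulr_sumr.
  by rewrite lowered_laplace -mulr_sumr; ring.
rewrite sumrB -mulr_sumr; by field.
Qed.

End algebra.

(** * The energy density of a harmonic map with potential *)
Section smooth.
Variables (R : realType) (n : nat).

Lemma smooth_on_partial (W : normedModType R) U (f : 'rV[R]_n -> W) a :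
  smooth_on U f -> smooth_on U (partial a f).
Proof. by move=> sf s x Ux; rewrite -foldr_rcons; exact: sf. Qed.

Lemma smooth_on_diff (W : normedModType R) U (f : 'rV[R]_n -> W) y :
  open U -> smooth_on U f -> U y -> \forall z \near y, differentiable f z.
Proof.
move=> oU sf Uy; have : \forall z \near y, U z by exact: open_nbhs_nbhs.
by apply: filterS => z; exact: (sf [::]).
Qed.

Lemma smooth_on_C1_at U (f : 'rV[R]_n -> R) y : open U -> smooth_on U f -> U y -> C1_at y f.
Proof.
move=> oU sf Uy; split; first exact: smooth_on_diff oU sf Uy.
by move=> a; apply: differentiable_continuous; exact: (sf [:: a]).
Qed.

Lemma smooth_on_entry_C1_at p q U (f : 'rV[R]_n -> 'M[R]_(p, q)) y i j :
  open U -> smooth_on U f -> U y -> C1_at y (fun z => f z i j).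
Proof.
move=> oU sf Uy; have ndf := smooth_on_diff oU sf Uy.
apply: (@C1_at_build _ _ _ _ (fun a z => partial a f z i j)) => [|a|a].
- by apply: filterS ndf => z; exact: differentiable_entry.
- by apply: filterS ndf => z; exact: partial_entry.
apply: differentiable_continuous; apply: differentiable_entry.
exact: (sf [:: a]).
Qed.

End smooth.

Section geometry.
Variables (R : realType) (m n : nat) (N : riemannian_manifold R m).
Variables (V : N -> R) (phi : 'rV[R]_n -> N).
Hypothesis smV : smooth_function V.
Hypothesis smphi : smooth_map phi.
Hypothesis hphi : harmonic_with_potential phi V.

(** The components of the pullback metric [phi^* g]. *)
Definition dmap_inner_in (c : chart R m N) (a b : 'I_n) (x : 'rV[R]_n) : R :=
  bilin (metric c (cto c (phi x))) (dmap phi c a x) (dmap phi c b x).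

Definition dmap_inner (a b : 'I_n) (x : 'rV[R]_n) : R :=
  dmap_inner_in (chart_at (phi x)) a b x.

Lemma near_chart (c : chart R m N) x : cdom c (phi x) -> \forall z \near x, cdom c (phi z).
Proof.
move=> cx; apply: (smphi.1); apply: open_nbhs_nbhs; split => //; exact: cdom_open.
Qed.

(** Two charts change [dphi(e_a)] by the Jacobian of the transition map and the
metric by its inverse congruence, so the inner product does not change. *)
Lemma dmap_innerE (c : chart R m N) a b x : atlas c -> cdom c (phi x) ->
  dmap_inner a b x = dmap_inner_in c a b x.
Proof.
move=> ac cx; have [phic phis] := smphi.
rewrite /dmap_inner /dmap_inner_in /chart_at.
case: cid2 => c' ac' c'x /=.
set y := cto c' (phi x).
have oy : overlap c' c y by split; [exact: cto_sub | rewrite /y ctoK].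
have d' : differentiable (cto c' \o phi) x by exact: (phis _ ac' [::]).
have dt : differentiable (transition c' c) y by exact: (atlas_smooth ac' ac [::]).
have E : \forall z \near x, (cto c \o phi) z = (transition c' c \o (cto c' \o phi)) z.
  by apply: filterS (near_chart c'x) => z h; rewrite /transition /= ctoK.
have dE e : dmap phi c e x = dmap phi c' e x *m jacobian (transition c' c) y.
  rewrite /dmap /partial (near_eq_derive _ E).
  rewrite (deriveE _ (differentiable_comp d' dt)) (deriveE _ d').
  rewrite /jacobian mul_rV_lin1.
  exact: (congr1 (fun h : _ -> _ => h (delta_mx 0 e)) (diff_comp d' dt)).
rewrite !dE (metric_compat ac' ac oy) /bilin /transition /= /y ctoK //.
by rewrite trmx_mul !mulmxA.
Qed.

Lemma bilinE (G : 'M[R]_m) (u v : 'rV[R]_m) :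
  bilin G u v = \sum_(i < m) \sum_(j < m) u 0 i * G i j * v 0 j.
Proof.
rewrite /bilin mxE exchange_big/=; apply: eq_bigr => j _.
by rewrite !mxE mulr_suml.
Qed.

Section chart.
Variables (c : chart R m N) (ac : atlas c).
Let U := phi @^-1` cdom c.
Let u := cto c \o phi.

Let oU : open U.
Proof. by apply: open_comp; [move=> x _; exact: smphi.1|exact: cdom_open]. Qed.

Let su : smooth_on U u. Proof. exact: smphi.2. Qed.

Lemma chart_cod x : U x -> ccod c (u x). Proof. exact: cto_sub. Qed.

Lemma C1_at_metric x i j : U x -> C1_at x (fun z => metric c (u z) i j).
Proof.
move=> Ux; apply: (@C1_at_comp _ _ _ _ u (fun w => metric c w i j)).
- exact: smooth_on_diff oU su Ux.
- by move=> k; exact: smooth_on_entry_C1_at oU su Ux.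
- exact: smooth_on_entry_C1_at (ccod_open (c:=c)) (metric_smooth ac) (chart_cod Ux).
Qed.

Lemma C1_at_dmap x a i : U x -> C1_at x (fun z => dmap phi c a z 0 i).
Proof. move=> Ux; exact: smooth_on_entry_C1_at oU (smooth_on_partial a su) Ux. Qed.

Lemma C1_at_potential x : U x -> C1_at x (fun z => V (phi z)).
Proof.
move=> Ux; apply: (@near_eq_C1_at _ _ (fun z => (V \o cfrom c) (u z))).
  by apply: filterS (near_chart Ux) => z Uz; rewrite /u /= ctoK.
apply: C1_at_comp.
- exact: smooth_on_diff oU su Ux.
- by move=> k; exact: smooth_on_entry_C1_at oU su Ux.
- exact: smooth_on_C1_at (ccod_open (c:=c)) (smV ac) (chart_cod Ux).
Qed.

Lemma C1_at_dmap_inner_in x a b : U x -> C1_at x (dmap_inner_in c a b).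
Proof.
move=> Ux; rewrite (_ : dmap_inner_in c a b = fun z => \sum_(i < m) \sum_(j < m)
   dmap phi c a z 0 i * metric c (u z) i j * dmap phi c b z 0 j); last first.
  by apply/funext => z; rewrite /dmap_inner_in bilinE.
apply: C1_at_sum => i; apply: C1_at_sum => j.
apply: C1_atM; last exact: C1_at_dmap.
by apply: C1_atM; [exact: C1_at_dmap|exact: C1_at_metric].
Qed.

Section point.
Variables (x : 'rV[R]_n) (Ux : U x).
Let g (i j : 'I_m) : R := metric c (u x) i j.
Let ginv (i j : 'I_m) : R := inv_metric c (u x) i j.
Let dg (l i j : 'I_m) : R := partial l (fun w => metric c w i j) (u x).
Let w (a : 'I_n) (i : 'I_m) : R := dmap phi c a x 0 i.
Let h (a b : 'I_n) (i : 'I_m) : R := partial a (dmap phi c b) x 0 i.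
Let dv (l : 'I_m) : R := partial l (V \o cfrom c : _ -> R) (u x).

Lemma partial_dmap_inner_in e a b :
  partial e (dmap_inner_in c a b) x = dmetric_inner g dg w h e a b.
Proof.
rewrite (_ : dmap_inner_in c a b = fun z => \sum_(i < m) \sum_(j < m)
   dmap phi c a z 0 i * metric c (u z) i j * dmap phi c b z 0 j); last first.
  by apply/funext => z; rewrite /dmap_inner_in bilinE.
have d1 f i : differentiable (fun z => dmap phi c f z 0 i) x by exact: C1_at_diff (C1_at_dmap _ _ Ux).
have d2 i j : differentiable (fun z => metric c (u z) i j) x by exact: C1_at_diff (C1_at_metric _ _ Ux).
have d3 i j : differentiable (fun z => dmap phi c a z 0 i * metric c (u z) i j) x by exact: differentiableM.
have d4 i j : differentiable (fun z => dmap phi c a z 0 i * metric c (u z) i j * dmap phi c b z 0 j) x.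
  exact: differentiableM.
rewrite partial_sum => [|i]; last exact: differentiable_sumE.
apply: eq_bigr => i _; rewrite partial_sum//; apply: eq_bigr => j _.
rewrite partialM// partialM//.
have hE f k : partial e (fun z => dmap phi c f z 0 k) x = h e f k.
  by rewrite /h partial_entry//; exact: (su [:: f] Ux).
rewrite !hE (partial_comp (u := u) (g := fun w => metric c w i j)).
- by rewrite /g /w /dg /dmap; ring.
- exact: (su [::] Ux).
- exact: C1_at_diff (smooth_on_entry_C1_at _ _ (ccod_open (c:=c)) (metric_smooth ac) (chart_cod Ux)).
Qed.

Lemma partial_potential b : partial b (fun z => V (phi z)) x = \sum_(l < m) dv l * w b l.
Proof.
rewrite /partial (@near_eq_derive _ _ _ _ (fun z => (V \o cfrom c) (u z))).
  rewrite -/(partial b _ x) partial_comp//.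
    exact: (su [::] Ux).
  exact: C1_at_diff (smooth_on_C1_at (ccod_open (c:=c)) (smV ac) (chart_cod Ux)).
by apply: filterS (near_chart Ux) => z Uz; rewrite /u /= ctoK.
Qed.

Lemma metric_unit : metric c (u x) \in unitmx.
Proof.
rewrite -row_free_unit; apply: inj_row_free => v vG; apply/eqP/negPn/negP => v0.
by have := metric_pos ac (chart_cod Ux) v0; rewrite /bilin vG mul0mx mxE ltxx.
Qed.

(** Here the equation of the map enters, through its components in the chart. *)
Lemma energy_conservation_in b :
  2^-1 * (\sum_(a < n) partial b (dmap_inner_in c a a) x) - partial b (fun z => V (phi z)) x =
  \sum_(a < n) partial a (dmap_inner_in c a b) x.
Proof.
have E1 : \sum_(a < n) partial b (dmap_inner_in c a a) x = \sum_(a < n) dmetric_inner g dg w h b a a.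
  by apply: eq_bigr => a _; exact: partial_dmap_inner_in.
have E2 : \sum_(a < n) partial a (dmap_inner_in c a b) x = \sum_(a < n) dmetric_inner g dg w h a a b.
  by apply: eq_bigr => a _; exact: partial_dmap_inner_in.
apply: etrans (congr2 (fun p q => 2^-1 * p - q) E1 (partial_potential b)) _.
apply: etrans _ (esym E2).
have ux := chart_cod Ux.
apply: (@dmetric_inner_conservation R m n g ginv dg w h dv).
- by move=> i j; rewrite /g -[in LHS](Defs.metric_sym ac ux) mxE.
- move=> a e i.
  have E f : \forall z \near x, dmap phi c f z 0 i = partial f (fun z => u z 0 i) z.
    by apply: filterS (smooth_on_diff oU su Ux) => z; exact: partial_entry.
  have H k f : h k f i = partial k (partial f (fun z => u z 0 i)) x.
    apply: etrans (partial_entry k 0 i (su [:: f] Ux)) _.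
    exact: (@near_eq_derive R 'rV[R]_n R _ _ x (delta_mx 0 k) (E f)).
  apply: etrans (H a e) _; apply: etrans _ (esym (H e a)).
  apply: clairaut.
  + by apply: filterS (smooth_on_diff oU su Ux) => z; exact: differentiable_entry.
  + exact: near_eq_C1_at (E a) (C1_at_dmap _ _ Ux).
  + exact: near_eq_C1_at (E e) (C1_at_dmap _ _ Ux).
- move=> p l; have := mulmxV metric_unit.
  by move=> /matrixP/(_ p l); rewrite !mxE => <-; apply: eq_bigr.
- move=> k; have := hphi ac Ux => /rowP/(_ k); rewrite /tension summxE !mxE => <-.
  apply: eq_bigr => a _; rewrite !mxE; congr (_ + _).
Qed.

End point.
End chart.

Definition energy_density (y : 'rV[R]_n) := 2^-1 * dmap_sqnorm phi y - V (phi y).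

Lemma chart_of x : exists2 c : chart R m N, atlas c & cdom c (phi x).
Proof. exact: atlas_cover. Qed.

Lemma near_dmap_inner (c : chart R m N) a b x : atlas c -> cdom c (phi x) ->
  \forall z \near x, dmap_inner_in c a b z = dmap_inner a b z.
Proof. by move=> ac cx; apply: filterS (near_chart cx) => z cz; rewrite (dmap_innerE _ _ ac cz). Qed.

Lemma C1_dmap_inner a b : C1 (dmap_inner a b).
Proof.
move=> x; have [c ac cx] := chart_of x.
exact: near_eq_C1_at (near_dmap_inner a b ac cx) (C1_at_dmap_inner_in ac a b cx).
Qed.

Lemma C1_potential : C1 (fun y => V (phi y)).
Proof. by move=> x; have [c ac cx] := chart_of x; exact: (C1_at_potential ac cx). Qed.

Lemma energy_densityE y : energy_density y =
  2^-1 * (\sum_(a < n) dmap_inner a a y) + -1 * V (phi y).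
Proof. by rewrite mulN1r. Qed.

Lemma C1_energy_density : C1 energy_density.
Proof.
rewrite (funext energy_densityE) => y; apply: C1_atD; apply: C1_atM.
- exact: C1_at_cst.
- by apply: C1_at_sum => a; exact: C1_dmap_inner.
- exact: C1_at_cst.
- exact: C1_potential.
Qed.

Lemma energy_conservation b y :
  partial b energy_density y = \sum_(a < n) partial a (dmap_inner a b) y.
Proof.
have [c ac cy] := chart_of y.
have pE e a f : partial e (dmap_inner a f) y = partial e (dmap_inner_in c a f) y.
  by apply/esym; apply: near_eq_derive; exact: near_dmap_inner.
under eq_bigr do rewrite pE.
rewrite -energy_conservation_in// (funext energy_densityE).
have dk (k : R) : differentiable (fun _ : 'rV[R]_n => k) y by exact: C1_at_diff (C1_at_cst y k).
have dV := C1_diff C1_potential y.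
have dS : differentiable (fun z => \sum_(a < n) dmap_inner a a z) y.
  by apply: differentiable_sumE => a; exact: C1_diff (C1_dmap_inner a a) y.
rewrite partialD; [|exact: differentiableM|exact: differentiableM].
rewrite !partialM// !partial_cst !mulr0 !addr0 mulN1r; congr (_ * _ - _).
rewrite partial_sum => [|a]; last exact: C1_diff (C1_dmap_inner a a) y.
by apply: eq_bigr => a _; exact: pE.
Qed.

(** The quadratic form is the squared length of [dphi(z)]. *)
Lemma dmap_inner_psd y (z : 'rV[R]_n) :
  0 <= \sum_(a < n) \sum_(b < n) z 0 a * z 0 b * dmap_inner a b y.
Proof.
have [c ac cy] := chart_of y.
pose v := \sum_(a < n) z 0 a *: dmap phi c a y.
have -> : \sum_(a < n) \sum_(b < n) z 0 a * z 0 b * dmap_inner a b y =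
    bilin (metric c (cto c (phi y))) v v.
  rewrite /bilin /v mulmx_suml mulmx_suml summxE; apply: eq_bigr => a _.
  rewrite linear_sum/= mulmx_sumr summxE; apply: eq_bigr => b _.
  rewrite (dmap_innerE _ _ ac cy) /dmap_inner_in /bilin.
  by rewrite linearZ/= -!scalemxAl -scalemxAr !mxE mulrA.
have [->|v0] := eqVneq v 0; first by rewrite /bilin !mul0mx mxE.
by apply: ltW; apply: metric_pos => //; exact: cto_sub.
Qed.

End geometry.

Theorem corollary2p15 (R : realType) (m n : nat) (N : riemannian_manifold R m)
    (V : N -> R) (phi : 'rV[R]_n -> N) :
  smooth_function V ->
  smooth_map phi ->
  harmonic_with_potential phi V ->
  (forall x, V (phi x) <= 0) ->
  forall (x : 'rV[R]_n) (r : R), 0 < r ->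
    let F := fun s : R => (s ^ (n%:Z - 2))^-1 *
      eintegral (eball x s) (fun y => 2^-1 * dmap_sqnorm phi y - V (phi y)) in
    derivable F r 1 /\ 0 <= derive1 F r.
Proof.
move=> smV smphi hphi V0 x r r0.
apply: (@stress_energy_monotonicity R n (energy_density V phi) (dmap_inner phi) x r) => //.
- exact: C1_energy_density.
- by move=> a b; exact: C1_dmap_inner.
- by move=> b y; exact: energy_conservation.
- move=> y; rewrite energy_densityE mulrDr mulrA divff// mul1r lerDl mulN1r.
  by rewrite mulr_ge0// oppr_ge0.
- exact: dmap_inner_psd.
Qed.
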